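(* Let $\chi:F_2=\langle a,b\rangle\to\mathbb Z/2\mathbb Z$ be the homomorphism with $\chi(a)=\chi(b)=1$. Let $(N_n)_{n\ge1}$ be a sequence of finite-index normal subgroups of $F_2$ with $N_n\subseteq\ker\chi$ for every $n$, $\bigcap_{n\ge1}N_n=\{e\}$, and such that the left translation actions $\sigma_n^{\rm bip}:F_2\to\operatorname{Sym}(V_n)$ on $V_n=F_2/N_n$ form a homomorphic sofic approximation $\Sigma_{\rm bip}=(\sigma_n^{\rm bip})_{n\ge1}$ of $F_2$. Then for every $n$, $$\alpha(\mathcal G_{\sigma_n^{\rm bip}})=\frac{|V_n|}{2}.$$ Consequently $$\operatorname{mdim}_{\Sigma_{\rm bip}}(X_{\rm hc})=\frac12,$$ where $X_{\rm hc}$ is the hard-core subshift over $F_2$.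
   Context: $F_2=\langle a,b\rangle$ is the free group on $a,b$, with identity $e$. Hard-core subshift: $X_{\rm hc}=\{x\in[0,1]^{F_2}: x_gx_{gs}=0\text{ for all }g\in F_2,\ s\in\{a,b\}\}$ (product topology), with $F_2$ acting by the left shift $(hx)_g=x_{h^{-1}g}$. Homomorphic sofic approximation of $F_2$: a sequence $\Sigma=(\sigma_n:F_2\to\operatorname{Sym}(V_n))_{n\ge1}$ of group homomorphisms, with $V_n$ finite, $|V_n|\to\infty$, and $|\{v\in V_n:\sigma_n(g)v=v\}|/|V_n|\to0$ for every $g\ne e$. Action graph: for a homomorphism $\sigma:F_2\to\operatorname{Sym}(V)$, $V$ finite, $\mathcal G_\sigma$ is the undirected multigraph with vertex set $V$ and edges $\{v,\sigma(s)v\}$, $v\in V$, $s\in\{a,b\}$ (loops and multiple edges allowed). A set $I\subseteq V$ is independent if it contains no two endpoints of an edge and no looped vertex; $\alpha(\mathcal G_\sigma)$ is the maximum size of an independent set. Microstates: let $G$ be a countable group acting continuously on a compact metrizable space $X$, and $\rho$ a continuous pseudometric on $X$. For $\varphi,\psi:V\to X$ ($V$ finite) put $\rho_2(\varphi,\psi)=\big(\frac1{|V|}\sum_{v\in V}\rho(\varphi(v),\psi(v))^2\big)^{1/2}$. For finite nonempty $F\subseteq G$, $\delta>0$ and $\sigma:G\to\operatorname{Sym}(V)$, let $\operatorname{Map}(\rho,F,\delta,\sigma)$ be the set of $\varphi:V\to X$ with $\rho_2(\varphi\circ\sigma(s),s\varphi)\le\delta$ for all $s\in F$, where $(s\varphi)(v)=s(\varphi(v))$.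 Sofic mean dimension: for a finite open cover $\gamma$ of a space $Y$, $\operatorname{ord}(\gamma)=\max_{y\in Y}\sum_{U\in\gamma}1_U(y)-1$, and $D(\gamma)=\min_\beta\operatorname{ord}(\beta)$ over finite open covers $\beta$ of $Y$ refining $\gamma$ (every member of $\beta$ is contained in a member of $\gamma$). For a finite open cover $\mathcal U$ of $X$, $\mathcal U^V$ is the product cover of $X^V$ and $D(\mathcal U,\rho,F,\delta,\sigma)=D(\mathcal U^V|_{\operatorname{Map}(\rho,F,\delta,\sigma)})$. Then $$\operatorname{mdim}_\Sigma(X)=\sup_{\mathcal U}\inf_F\inf_{\delta>0}\limsup_{n\to\infty}\frac{D(\mathcal U,\rho,F,\delta,\sigma_n)}{|V_n|},$$ where $\rho$ is a compatible metric on $X$ (the value does not depend on it), $\mathcal U$ ranges over finite open covers of $X$ and $F$ over finite nonempty subsets of $G$. *)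

(* Defs.v *)
From HB Require Import structures.
From mathcomp Require Import all_boot all_order all_algebra all_fingroup finmap.
From mathcomp Require Import all_classical all_reals all_analysis.

Set Implicit Arguments.
Unset Strict Implicit.
Unset Printing Implicit Defensive.

Import Order.TTheory GRing.Theory Num.Theory.
Import numFieldNormedType.Exports.

Local Open Scope classical_set_scope.
Local Open Scope ring_scope.

(* The letter (s, e) is the generator s (false for a, true for b) if e = false,
   and its inverse if e = true. *)
Definition letter : Type := (bool * bool)%type.

Definition linv (l : letter) : letter := (l.1, ~~ l.2).

Definition reduced (w : seq letter) : bool :=
  sorted (fun l m => m != linv l) w.

Definition F2 : Type := {w : seq letter | reduced w}.
HB.instance Definition _ := Countable.on F2.

Definition lcons (l : letter) (w : seq letter) : seq letter :=
  if w is m :: w' then if m == linv l then w' else l :: w else [:: l].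

Definition mul_word (u v : seq letter) : seq letter := foldr lcons v u.
Definition inv_word (w : seq letter) : seq letter := rev (map linv w).

Lemma linvK : involutive linv.
Proof. by case=> s e; rewrite /linv /= negbK. Qed.

Lemma reduced_behead l w : reduced (l :: w) -> reduced w.
Proof. by case: w => //= m w /andP[]. Qed.

Lemma reduced_lcons l w : reduced w -> reduced (lcons l w).
Proof.
case: w => //= m w rw; case: ifPn => [_|nml]; last by rewrite /= nml.
exact: (@reduced_behead m).
Qed.

Lemma reduced_mul_word u v : reduced v -> reduced (mul_word u v).
Proof. by move=> rv; elim: u => //= l u; exact: reduced_lcons. Qed.

Lemma lconsK l w : reduced w -> lcons l (lcons (linv l) w) = w.
Proof.
case: w => [_|m w rw] /=; first by rewrite eqxx.
rewrite linvK; case: ifPn => [/eqP mE|_] /=; last by rewrite eqxx.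
move: rw; rewrite mE; case: w => //= p w /andP[/negPf nE _].
by rewrite nE.
Qed.

Lemma mul_lcons l u v : reduced v ->
  mul_word (lcons l u) v = lcons l (mul_word u v).
Proof.
move=> rv; case: u => //= m u; case: ifPn => //= /eqP ->.
by rewrite lconsK // reduced_mul_word.
Qed.

Lemma mul_wordA u v w : reduced w ->
  mul_word u (mul_word v w) = mul_word (mul_word u v) w.
Proof.
by move=> rw; elim: u => //= l u ->; rewrite mul_lcons.
Qed.

Lemma mul_word0 w : reduced w -> mul_word w [::] = w.
Proof.
elim: w => //= l w IHw rw; rewrite IHw; last exact: reduced_behead rw.
by case: w rw {IHw} => //= m w /andP[/negPf ->].
Qed.

Lemma mul_inv_word w v : reduced v -> mul_word (inv_word w) (mul_word w v) = v.
Proof.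
elim: w v => //= l w IHw v rv.
rewrite /inv_word /= rev_cons /mul_word foldr_rcons -/(mul_word w v).
rewrite -[X in lcons _ (lcons X _)]linvK lconsK.
  exact: IHw.
exact: reduced_mul_word.
Qed.

Lemma inv_wordK : involutive inv_word.
Proof.
by move=> w; rewrite /inv_word map_rev revK -map_comp (eq_map linvK) map_id.
Qed.

Lemma reduced_inv_word w : reduced w -> reduced (inv_word w).
Proof.
rewrite /reduced /inv_word rev_sorted sorted_map.
by apply: sub_sorted => l m /=; apply: contra_neq => ->; rewrite linvK.
Qed.

Definition F2_one : F2 := exist _ [::] isT.
Definition F2_mul (g h : F2) : F2 :=
  exist _ (mul_word (val g) (val h)) (reduced_mul_word (val g) (valP h)).
Definition F2_inv (g : F2) : F2 :=
  exist _ (inv_word (val g)) (reduced_inv_word (valP g)).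

Lemma F2_mulA : associative F2_mul.
Proof. by move=> g h k; apply/val_inj/mul_wordA/(valP k). Qed.
Lemma F2_mul1g : left_id F2_one F2_mul.
Proof. by move=> g; exact: val_inj. Qed.
Lemma F2_mulg1 : right_id F2_one F2_mul.
Proof. by move=> g; apply/val_inj/mul_word0/(valP g). Qed.
Lemma F2_mulVg : left_inverse F2_one F2_inv F2_mul.
Proof.
move=> g; apply: val_inj => /=.
by rewrite -{2}[val g](mul_word0 (valP g)) mul_inv_word.
Qed.
Lemma F2_mulgV : right_inverse F2_one F2_inv F2_mul.
Proof.
move=> g; have gE : F2_inv (F2_inv g) = g by apply/val_inj/inv_wordK.
by rewrite -{1}gE F2_mulVg.
Qed.

HB.instance Definition _ :=
  isGroup.Build F2 F2_mulA F2_mul1g F2_mulg1 F2_mulVg F2_mulgV.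

Definition gen (s : bool) : F2 := exist _ [:: (s, false)] isT.
Definition gen_a : F2 := gen false.
Definition gen_b : F2 := gen true.

Section Cosets.
Variable G : groupType.

Definition ltrans (g : G) (C : set G) : set G := [set (g * h)%g | h in C].

Definition lcosets_of (N : set G) : set (set G) := range (fun g => ltrans g N).

Record fin_index_normal := FinIndexNormal {
  fin_normal_set :> set G;
  fin_normal1 : fin_normal_set 1%g;
  fin_normalM : forall g h,
    fin_normal_set g -> fin_normal_set h -> fin_normal_set (g * h)%g;
  fin_normalV : forall g, fin_normal_set g -> fin_normal_set (g^-1)%g;
  fin_normalJ : forall g h,
    fin_normal_set h -> fin_normal_set (g * h * g^-1)%g;
  fin_normal_index : finite_set (lcosets_of fin_normal_set) }.

Lemma ltransM g h C : ltrans g (ltrans h C) = ltrans (g * h)%g C.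
Proof.
rewrite eqEsubset; split=> [_ [_ [k Ck <-] <-]|_ [k Ck <-]].
  by exists k; rewrite ?mulgA.
by exists (h * k)%g; [exists k|rewrite mulgA].
Qed.

Lemma ltrans1 C : ltrans 1%g C = C.
Proof.
rewrite eqEsubset; split=> [_ [k Ck <-]|k Ck]; first by rewrite mul1g.
by exists k; rewrite ?mul1g.
Qed.

Variable N : fin_index_normal.

Definition quot : finType := fset_set (lcosets_of N).

Lemma ltrans_quot g (C : quot) : ltrans g (val C) \in fset_set (lcosets_of N).
Proof.
have fN := fin_normal_index N.
have := valP C; rewrite !in_fset_set // => /set_mem[h _ <-].
by apply/mem_set; exists (g * h)%g; rewrite ?ltransM.
Qed.

Definition quot_ltrans (g : G) (C : quot) : quot := FSetSub (ltrans_quot g C).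

Lemma quot_ltrans_inj g : injective (quot_ltrans g).
Proof.
move=> C D /(congr1 val)/(congr1 (ltrans g^-1%g)) /=.
by rewrite !ltransM mulVg !ltrans1 => /val_inj.
Qed.

Definition translation (g : G) : {perm quot} := perm (@quot_ltrans_inj g).

End Cosets.

(* The product of {perm V} composes from left to right, so that a homomorphism
   to Sym(V), with its usual right-to-left composition, is not a morphism for
   that product; it is spelt out pointwise. *)
Definition perm_hom (G : groupType) (V : finType) (sigma : G -> {perm V}) :=
  forall g h v, sigma (g * h)%g v = sigma g (sigma h v).

Record hom_sofic_approx (R : realType) (G : groupType) (V : nat -> finType)
    (sigma : forall n, G -> {perm V n}) : Prop := HomSoficApprox {
  sofic_hom : forall n, perm_hom (sigma n);
  sofic_card : (fun n => #|V n|) @ \oo --> \oo;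
  sofic_free : forall g : G, g <> 1%g ->
    (fun n => #|[set v | sigma n g v == v]%SET|%:R / #|V n|%:R : R) @ \oo --> 0
}.

Record multigraph := Multigraph {
  vertex : finType;
  edge : finType;
  ends : edge -> vertex * vertex }.

(* The condition also excludes looped vertices: a loop has equal endpoints. *)
Definition independent (Gr : multigraph) (I : {set vertex Gr}) : bool :=
  [forall e : edge Gr, ~~ (((ends e).1 \in I) && ((ends e).2 \in I))].

Definition alpha (Gr : multigraph) : nat :=
  \max_(I : {set vertex Gr} | independent I) #|I|.

Definition action_graph (V : finType) (sigma : F2 -> {perm V}) : multigraph :=
  {| vertex := V; edge := (V * bool)%type;
     ends := fun e => (e.1, sigma (gen e.2) e.1) |}.

Section CoveringDimension.
Variables (R : realType) (Y : topologicalType).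

Definition fin_open_cover (gamma : set (set Y)) : Prop :=
  [/\ finite_set gamma, forall U, gamma U -> open U
    & \bigcup_(U in gamma) U = [set: Y]].

Definition refines (beta gamma : set (set Y)) : Prop :=
  forall U, beta U -> exists2 W, gamma W & U `<=` W.

(* Extended-real valued, so that ord = D = -oo on the empty space; otherwise
   the supremum and the infimum range over bounded sets of integers and are
   attained. *)
Definition ord (gamma : set (set Y)) : \bar R :=
  ereal_sup [set (\sum_(U \in gamma) (\1_U y : R) - 1)%:E | y in [set: Y]].

Definition covdim (gamma : set (set Y)) : \bar R :=
  ereal_inf [set ord beta | beta in
    [set beta | fin_open_cover beta /\ refines beta gamma]].

End CoveringDimension.

Section MeanDimension.
Variables (R : realType) (G : groupType) (X : topologicalType).
Variables (act : G -> X -> X) (rho : X -> X -> R).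

Record compatible_metric : Prop := CompatibleMetric {
  rho_ge0 : forall x y, 0 <= rho x y;
  rho_eq0 : forall x y, rho x y = 0 <-> x = y;
  rho_sym : forall x y, rho x y = rho y x;
  rho_triangle : forall x y z, rho x z <= rho x y + rho y z;
  rho_nbhs : forall x (A : set X),
    nbhs x A <-> exists2 e, 0 < e & [set y | rho x y < e] `<=` A }.

Section Microstates.
Variable V : finType.

Definition rho2 (phi psi : V -> X) : R :=
  Num.sqrt (#|V|%:R^-1 * \sum_(v : V) rho (phi v) (psi v) ^+ 2).

Definition Map (F : set G) (delta : R) (sigma : G -> {perm V}) :
    set {ptws V -> X} :=
  [set phi | forall s, F s ->
    rho2 (fun v => phi (sigma s v)) (fun v => act s (phi v)) <= delta].

Definition prod_cover (U : set (set X)) : set (set {ptws V -> X}) :=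
  [set [set phi : {ptws V -> X} | forall v, W v (phi v)] |
    W in [set W : V -> set X | forall v, U (W v)]].

Definition Dmap (U : set (set X)) F delta (sigma : G -> {perm V}) : \bar R :=
  covdim R [set (@set_val _ (Map F delta sigma)) @^-1` W | W in prod_cover U].

End Microstates.

Definition mdim (V : nat -> finType) (sigma : forall n, G -> {perm V n}) :
    \bar R :=
  ereal_sup [set
    ereal_inf [set
      ereal_inf [set
        limn_esup (fun n =>
          (Dmap U F delta (sigma n) * (#|V n|%:R^-1)%:E)%E)
        | delta in [set delta : R | 0 < delta]]
      | F in [set F : set G | finite_set F /\ F !=set0]]
    | U in @fin_open_cover X].

End MeanDimension.

Section HardCore.
Variable R : realType.

Definition hc_set : set {ptws F2 -> R} :=
  [set x | (forall g, 0 <= x g <= 1) /\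
           (forall g s, x g * x (g * gen s)%g = 0)].

(* The subspace topology of the product topology on R^F2, which on hc_set is
   also that induced by [0, 1]^F2. *)
Definition hardcore : topologicalType := hc_set.

Definition hc_val : hardcore -> {ptws F2 -> R} := @set_val _ hc_set.

Definition shift_fun (h : F2) (x : {ptws F2 -> R}) : {ptws F2 -> R} :=
  fun g => x (h^-1 * g)%g.

Lemma shift_hc h (x : hardcore) : shift_fun h (hc_val x) \in hc_set.
Proof.
have [x01 x0] := set_mem (valP x); apply/mem_set; split=> [g|g s].
  exact: x01.
by rewrite /shift_fun mulgA.
Qed.

Definition hc_shift (h : F2) (x : hardcore) : hardcore :=
  exist _ (shift_fun h (hc_val x)) (shift_hc h x).

End HardCore.

Section HardCoreMetric.
Variable R : realType.

Definition hc_gap (x y : hardcore R) (g : F2) : R :=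
  (choice.pickle g).+1%:R^-1 * `|hc_val x g - hc_val y g|.

Definition hc_metric (x y : hardcore R) : R := sup (range (hc_gap x y)).

Lemma hc_dist_le1 (x y : hardcore R) g : `|hc_val x g - hc_val y g| <= 1.
Proof.
have [x01 _] := set_mem (valP x); have [y01 _] := set_mem (valP y).
have /andP[x0 x1] := x01 g; have /andP[y0 y1] := y01 g.
rewrite ler_norml; apply/andP; split.
  rewrite lerBrDr; apply: le_trans x0; rewrite addrC subr_le0; exact: y1.
by rewrite lerBlDr; apply: le_trans x1 _; rewrite lerDl.
Qed.

Lemma hc_gap_le1 x y g : hc_gap x y g <= 1.
Proof.
by rewrite /hc_gap mulr_ile1 // ?invr_ge0 // ?hc_dist_le1 // invf_le1 // ler1n.
Qed.

Lemma hc_gap_le x y g : hc_gap x y g <= hc_metric x y.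
Proof.
apply: sup_upper_bound; last by exists g.
split; first by exists (hc_gap x y 1%g); exists 1%g.
by exists 1 => _ [h _ <-]; exact: hc_gap_le1.
Qed.

Lemma hc_metric_le x y r :
  (forall g, hc_gap x y g <= r) -> hc_metric x y <= r.
Proof.
move=> xyr; apply: ge_sup; first by exists (hc_gap x y 1%g); exists 1%g.
by move=> _ [g _ <-].
Qed.

Lemma hc_gap_ge0 x y g : 0 <= hc_gap x y g.
Proof. by rewrite /hc_gap mulr_ge0. Qed.

Lemma cvg_hc_coord (F : set_system (hardcore R)) (x : hardcore R) :
  Filter F -> (forall g, (fun y : hardcore R => hc_val y g) @ F --> hc_val x g) ->
  F --> x.
Proof.
move=> FF Fx A; rewrite nbhsE => -[_ [[B oB <-] Bx] /filterS]; apply.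
suff Fval : @hc_val R @ F -->
    hc_val x.
  exact/Fval/open_nbhs_nbhs.
apply/cvg_sup => g C; rewrite (@nbhsE (initial_topology _)).
move=> [_ [[D oD <-] Dx] DC]; apply: (filterS DC).
by apply/Fx/open_nbhs_nbhs.
Qed.

Lemma hc_coord_continuous g : continuous (fun y : hardcore R => hc_val y g).
Proof.
move=> x; apply: (@continuous_comp _ _ _ (@hc_val R) (fun z : {ptws F2 -> R} => z g)).
  exact: initial_continuous.
exact: (@proj_continuous _ (fun=> R)).
Qed.

(* Hence a statement about all compatible metrics on hardcore is not vacuous. *)
Lemma hc_metric_compatible : compatible_metric hc_metric.
Proof.
have ge0 x y : 0 <= hc_metric x y.
  exact: le_trans (hc_gap_ge0 x y 1%g) (hc_gap_le x y 1%g).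
split=> // [x y|x y|x y z|x A].
- split=> [xy0|->]; last first.
    apply/eqP; rewrite eq_le ge0 andbT; apply: hc_metric_le => g.
    by rewrite /hc_gap subrr normr0 mulr0.
  apply/val_inj/funext => g; apply/eqP; rewrite -subr_eq0 -normr_eq0.
  have /eqP : hc_gap x y g = 0.
    by apply/eqP; rewrite eq_le hc_gap_ge0 -xy0 hc_gap_le.
  by rewrite /hc_gap mulf_eq0 invr_eq0 pnatr_eq0.
- rewrite /hc_metric; suff -> : hc_gap x y = hc_gap y x by [].
  by apply/funext => g; rewrite /hc_gap distrC.
- apply: hc_metric_le => g.
  apply: le_trans (lerD (hc_gap_le x y g) (hc_gap_le y z g)).
  by rewrite /hc_gap -mulrDr ler_wpM2l // ler_distD.
split=> [|[e e0 eA]].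
- pose F : set_system (hardcore R) :=
    [set B | exists2 e, 0 < e & [set y | hc_metric x y < e] `<=` B].
  have FF : Filter F.
    split=> [|P Q [d d0 dP] [e e0 eQ]|P Q PQ [e e0 eP]].
    + by exists 1.
    + exists (Num.min d e); first by rewrite lt_min d0.
      by move=> y /=; rewrite lt_min => /andP[/dP ? /eQ].
    + by exists e => // y /eP /PQ.
  suff Fx : F --> x by exact: Fx.
  apply: cvg_hc_coord => g; apply/cvgrPdist_lt => e e0.
  exists ((choice.pickle g).+1%:R^-1 * e); first by rewrite mulr_gt0 // invr_gt0.
  move=> y /=; apply: contraPP => /negP; rewrite -leNgt => exy.
  apply/negP; rewrite -leNgt; apply: le_trans (hc_gap_le x y g).
  by rewrite /hc_gap ler_wpM2l.
- have e20 : 0 < e / 2 by rewrite divr_gt0.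
  have [n _ nP] := near_infty_natSinv_lt (PosNum e20).
  have near_xy (i : 'I_n) : \forall y \near x, forall g : F2,
      choice.pickle g = i -> `|hc_val x g - hc_val y g| < e / 2.
    case: (pselect (exists g : F2, choice.pickle g = i)) => [[g gi]|ngi].
      have near_g : \forall y \near x, `|hc_val x g - hc_val y g| < e / 2.
        by have /cvgrPdist_lt/(_ _ e20) := @hc_coord_continuous g x.
      apply: (@filterS _ (nbhs x) (nbhs_filter x) _ _ _ near_g) => y xy h hi.
      by rewrite (pcan_inj choice.pickleK (etrans hi (esym gi))).
    by apply: (@filterE _ (nbhs x) (nbhs_filter x)) => y g gi; case: ngi; exists g.
  have near_x := @filter_forall _ _ _ (nbhs x) (nbhs_filter x) near_xy.
  apply: (@filterS _ (nbhs x) (nbhs_filter x) _ _ _ near_x) => y xy; apply: eA => /=.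
  apply: (@le_lt_trans _ _ (e / 2)); last by rewrite gtr_pMr // invf_lt1 // ltr1n.
  apply: hc_metric_le => g; have [gn|ng] := ltnP (choice.pickle g) n.
    apply: le_trans (ltW (xy (Ordinal gn) g erefl)).
    by rewrite /hc_gap ler_piMl // invf_le1 // ler1n.
  apply: le_trans (ltW (nP _ ng)); rewrite /hc_gap ler_piMr //.
  exact: hc_dist_le1.
Qed.

End HardCoreMetric.

(* Main.v *)
Require Import Defs.
From HB Require Import structures.
From mathcomp Require Import all_boot all_order all_algebra all_fingroup finmap.
From mathcomp Require Import all_classical all_reals all_analysis.
From mathcomp Require Import zify ring lra.

(* An independent set I is disjoint from its translate by a, so |I| <= |V|/2,
   and the cosets on which chi vanishes form an independent set of size |V|/2.

   Lower bound. For an independent set I, a point y of the cube [0,1]^I gives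
   the exactly equivariant microstate v |-> (g |-> y_(g^-1 v)), with y extended
   by 0 outside I. Pulled back to the cube, the cover {x_e < 1}, {x_e > 0} of
   the hard-core shift forces every member of a refinement to miss one of each
   pair of opposite faces, so Lebesgue's covering theorem yields order >= |I|.
   That theorem is derived from Kuhn's cubical form of Sperner's lemma.

   Upper bound. Up to small errors a microstate phi is determined by the values
   phi(v)_e and the defects phi(v)_g - phi(g^-1 v)_e for g in a finite set. For
   small delta, few defects exceed the threshold, and the v with phi(v)_e above
   the threshold form an independent set once the few v with a large defect at
   a or b are removed. After soft thresholding at most alpha + eps |V|
   coordinates are nonzero at any microstate, and a cover by cells of a cubical
   grid then has order at most alpha + eps |V|. *)

Set Implicit Arguments.
Unset Strict Implicit.
Unset Printing Implicit Defensive.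

Import Order.TTheory GRing.Theory Num.Theory.
Import numFieldNormedType.Exports.

(** * Kuhn's lemma *)

(** Points moved by [f] come in pairs; the induction removes one fixed point or one such pair at a
    time. *)
Lemma odd_involution (T : eqType) (s : seq T) (f : T -> T) : uniq s ->
  {in s, forall x, f x \in s} -> {in s, forall x, f (f x) = x} ->
  odd (size s) = odd (count (fun x => f x == x) s).
Proof.
move: {2}(size s) (leqnn (size s)) => n.
elim: n s => [|n IHn] s; first by rewrite leqn0 size_eq0 => /eqP ->.
case: s => // x s; rewrite ltnS => sn us fs ffs.
have [fx|nfx] := eqVneq (f x) x.
  rewrite [size _]/= [count _ _]/= fx eqxx /= (IHn s) //.
  - by case/andP: us.
  - move=> y ys; have := fs y; rewrite !inE ys orbT => /(_ isT).
    case/orP => // /eqP fyx; have := ffs y; rewrite inE ys orbT fyx fx => /(_ isT) yx.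
    by move: us; rewrite /= yx ys.
  - by move=> y ys; apply: ffs; rewrite inE ys orbT.
have fxs : f x \in s by have := fs x; rewrite !inE eqxx (negPf nfx); exact.
have ffx : f (f x) = x by apply: ffs; rewrite mem_head.
have [xs us'] := andP us.
have ps : perm_eq s (f x :: rem (f x) s) by exact: perm_to_rem.
rewrite [size _]/= [count _ _]/= (negPf nfx) (perm_size ps) (seq.permP ps).
rewrite [size _]/= [count _ _]/= ffx eq_sym (negPf nfx) /= negbK (IHn (rem (f x) s)) //.
- by rewrite size_rem // (leq_trans (leq_pred _)).
- exact: rem_uniq.
- move=> y; rewrite mem_rem_uniq // !inE => /andP[yfx ys].
  rewrite mem_rem_uniq // inE; apply/andP; split.
    apply: contraNneq xs => fyx.
    by rewrite -ffx -fyx ffs ?inE ?ys ?orbT.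
  have := fs y; rewrite !inE ys orbT => /(_ isT) /orP[/eqP fyx|//].
  by move: yfx; rewrite -fyx ffs ?eqxx // inE ys orbT.
- by move=> y /mem_rem ys; rewrite ffs // inE ys orbT.
Qed.

(** If [s] lists the colours of the vertices of a simplex, this lists those of the facet opposite to
    vertex [j]. *)
Definition rmnth (T : Type) j (s : seq T) := take j s ++ drop j.+1 s.

Lemma perm_rmnth (T : eqType) (x0 : T) j (s : seq T) : j < size s ->
  perm_eq s (nth x0 s j :: rmnth j s).
Proof.
move=> js; rewrite -{1}(cat_take_drop j s) (drop_nth x0) //.
by rewrite -cat_rcons -cats1 -catA perm_catCA.
Qed.

Lemma perm_iotaS d : perm_eq (iota 0 d.+1) (d :: iota 0 d).
Proof. by rewrite -addn1 iotaD /= cats1 perm_rcons. Qed.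

(* Some v satisfies s ~ v :: iota 0 d as soon as a door exists, and v is then
   unique, so the doors are the positions of v in s: one if v = d, two if
   v < d. *)
Lemma odd_doors d (s : seq nat) : size s = d.+1 -> all (fun v => v <= d) s ->
  odd (count (fun j => perm_eq (rmnth j s) (iota 0 d)) (iota 0 d.+1)) =
  perm_eq s (iota 0 d.+1).
Proof.
move=> ss sd.
rewrite (seq.permPr (perm_iotaS d)).
have dE j : j \in iota 0 d.+1 ->
    perm_eq (rmnth j s) (iota 0 d) = perm_eq s (nth 0 s j :: iota 0 d).
  rewrite mem_iota add0n => /= js.
  by rewrite (seq.permPl (@perm_rmnth _ 0 j s _)) ?ss // perm_cons.
rewrite (eq_in_count dE).
have [/hasP[j js pj]|/hasPn nd] :=
    boolP (has (fun j => perm_eq s (nth 0 s j :: iota 0 d)) (iota 0 d.+1)); last first.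
  rewrite (_ : count _ _ = 0); last first.
    by rewrite (eq_in_count (a2 := pred0)) ?count_pred0 // => i /nd /negPf.
  apply/esym/negP => ps.
  have ds : d \in s by rewrite (perm_mem ps) mem_head.
  have := nd (index d s); rewrite mem_iota add0n -ss index_mem ds nth_index //.
  by move/(_ isT); rewrite ps.
set v := nth 0 s j in pj.
have vE u : perm_eq s (u :: iota 0 d) = (u == v).
  apply/idP/eqP => [pu|-> //].
  have := perm_trans (_ : perm_eq (u :: iota 0 d) s) pj.
  rewrite perm_sym pu => /(_ isT) puv; apply/eqP.
  have : count_mem u (u :: iota 0 d) = count_mem u (v :: iota 0 d) by exact/seq.permP.
  by rewrite /= eqxx => /eqP; rewrite eqn_add2r eq_sym eqb1 eq_sym.
rewrite vE.
under eq_count do rewrite vE.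
rewrite -[count _ _](count_map (nth 0 s) (pred1 v)) -ss map_nth_iota0 // take_size.
rewrite (seq.permP pj) /= eqxx count_uniq_mem ?iota_uniq // mem_iota /= add0n.
have : v <= d by apply: (allP sd); rewrite mem_nth // ss; move: js; rewrite mem_iota.
by case: ltngtP.
Qed.

(* The simplices of the Freudenthal triangulation: from a corner x, increase the
   coordinates by 1 one after the other, in the order given by w. *)
Definition vert (x w : seq nat) (j : nat) : nat -> nat :=
  fun i => nth 0 x i + (i \in take j w).

Fixpoint grid (m d : nat) : seq (seq nat) :=
  if d is d'.+1 then [seq rcons x a | x <- grid m d', a <- iota 0 m] else [:: [::]].

Lemma mem_grid m d x :
  (x \in grid m d) = (size x == d) && all (fun a => a < m) x.
Proof.
elim: d x => [|d IHd] x; first by rewrite inE; case: x.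
apply/allpairsP/andP => [[[y a] /= [yd am ->]]|].
  move: yd; rewrite IHd => /andP[/eqP <- ym].
  by rewrite size_rcons all_rcons ym; move: am; rewrite mem_iota andbT.
case/lastP: x => [[]//|y a []].
rewrite size_rcons eqSS all_rcons => yd /andP[am ym].
by exists (y, a); rewrite IHd yd ym mem_iota.
Qed.

Lemma grid_uniq m d : uniq (grid m d).
Proof.
elim: d => //= d IHd; apply: allpairs_uniq; rewrite ?iota_uniq //.
by move=> [x a] [y b] _ _ /= /rcons_inj.
Qed.

(** For [0 < j < size w] two consecutive steps of the path are exchanged, which replaces its vertex
    [j] only. *)
Definition swap (T : Type) j (w : seq T) :=
  take j.-1 w ++ rev (take 2 (drop j.-1 w)) ++ drop j.+1 w.

Lemma swapE (T : Type) (u v : seq T) a b :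
  swap (size u).+1 (u ++ a :: b :: v) = u ++ b :: a :: v.
Proof.
rewrite /swap -[(size u).+2]/(2 + size u) -drop_drop /=.
by rewrite take_size_cat // !drop_size_cat //= take0 drop0.
Qed.

Lemma split_swap (T : Type) j (w : seq T) : 0 < j < size w ->
  exists u v a b, w = u ++ a :: b :: v /\ j = (size u).+1.
Proof.
case: j => // j /= jw; have jw' := ltnW jw.
exists (take j w), (drop j.+2 w).
have := cat_take_drop j w; have : size (drop j w) >= 2 by rewrite size_drop; lia.
rewrite -[drop j.+2 w]/(drop (2 + j) w) -drop_drop.
case: (drop j w) => [|a [|b v]] //= _ <-.
by exists a, b; rewrite drop0 take_size_cat ?size_takel // ltnW.
Qed.

(** Prefixes of every other length contain both or neither of the exchanged entries, so the two
    paths share all vertices but one. *)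
Lemma mem_take_swap (T : eqType) (u v : seq T) a b i : i != (size u).+1 ->
  take i (u ++ a :: b :: v) =i take i (u ++ b :: a :: v).
Proof.
move=> iu y; rewrite !take_cat; case: ltnP => // ui.
have : i - size u != 1 by lia.
by case: (i - size u) => [|[|n]] //= _; rewrite !mem_cat !inE [in LHS](orbCA (y == a)).
Qed.

Definition decr_nth (x : seq nat) i := set_nth 0 x i (nth 0 x i).-1.

Lemma incr_nthK x i : i < size x -> decr_nth (incr_nth x i) i = x.
Proof.
move=> ix; have sE : size (decr_nth (incr_nth x i) i) = size x.
  by rewrite size_set_nth size_incr_nth ix; apply/maxn_idPr.
apply: (@eq_from_nth _ 0) => // k _.
rewrite nth_set_nth /= !nth_incr_nth eqxx; by have [->|] := eqVneq k i.
Qed.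

Lemma decr_nthK x i : i < size x -> 0 < nth 0 x i -> incr_nth (decr_nth x i) i = x.
Proof.
move=> ix x0; have sE : size (decr_nth x i) = size x.
  by rewrite size_set_nth; apply/maxn_idPr.
apply: (@eq_from_nth _ 0) => [|k _]; first by rewrite size_incr_nth sE ix.
rewrite nth_incr_nth nth_set_nth /=; have [->|//] := eqVneq k i.
by rewrite add1n prednK.
Qed.

(** * Parity of the numbers of doors and rainbow simplices *)

Section Kuhn.
Variables (m D : nat) (c : (nat -> nat) -> nat).
Hypothesis m_gt0 : 0 < m.
(** Points are functions on all of [nat], and vertices of [d]-dimensional simplices vanish from
    coordinate [d] on. This condition limits them to the colours [0 .. d], so one colouring serves
    every dimension of the induction. *)
Hypothesis c_face0 : forall x i, i <= D -> (forall k, x k <= m) -> x i = 0 ->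
  c x <= i.
Hypothesis c_facem : forall x i, i < D -> (forall k, x k <= m) -> x i = m ->
  c x <> i.

Definition colours d (x w : seq nat) := [seq c (vert x w j) | j <- iota 0 d.+1].

Definition simplices d : seq (seq nat * seq nat) :=
  [seq (x, w) | x <- grid m d, w <- permutations (iota 0 d)].

Definition rainbow d (t : seq nat * seq nat) :=
  perm_eq (colours d t.1 t.2) (iota 0 d.+1).

Definition door d (p : seq nat * seq nat * nat) :=
  perm_eq (rmnth p.2 (colours d p.1.1 p.1.2)) (iota 0 d).

Lemma mem_simplices d x w : ((x, w) \in simplices d) =
  [&& size x == d, all (fun a => a < m) x & perm_eq w (iota 0 d)].
Proof.
rewrite andbA -mem_grid -[perm_eq _ _]mem_permutations.
apply/allpairsP/andP => [[[y v] /= [ym vd [-> ->]]]//|[xm wd]].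
by exists (x, w).
Qed.

Lemma simplices_uniq d : uniq (simplices d).
Proof.
apply: allpairs_uniq; rewrite ?grid_uniq ?permutations_uniq //.
by move=> [x a] [y b] _ _.
Qed.

Lemma vert_le d x w j : (x, w) \in simplices d -> forall k, vert x w j k <= m.
Proof.
rewrite mem_simplices => /and3P[/eqP sx /allP xm pw] k; rewrite /vert.
have [kd|dk] := ltnP k (size x); last first.
  rewrite nth_default // (_ : (k \in _) = false) //.
  apply/negP => /mem_take; rewrite (perm_mem pw) mem_iota add0n /=.
  by move: dk; rewrite sx; case: ltngtP.
have := xm _ (mem_nth 0 kd); case: (_ \in _) => /=; lia.
Qed.

Lemma size_colours d x w : size (colours d x w) = d.+1.
Proof. by rewrite size_map size_iota. Qed.

Lemma colours_le d t : d <= D -> t \in simplices d ->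
  all (fun v => v <= d) (colours d t.1 t.2).
Proof.
case: t => x w dD xw; apply/allP => _ /mapP[j _ ->].
apply: c_face0 => //; first exact: vert_le xw.
move: xw; rewrite mem_simplices => /and3P[/eqP sx _ pw].
rewrite /vert nth_default ?sx //= (_ : (d \in _) = false) //.
by apply/negP => /mem_take; rewrite (perm_mem pw) mem_iota add0n ltnn andbF.
Qed.

Definition pairs d : seq (seq nat * seq nat * nat) :=
  [seq (t, j) | t <- simplices d, j <- iota 0 d.+1].

(** By [odd_doors] a simplex contributes an odd number of doors exactly when it is rainbow. *)
Lemma odd_count_doors d : d <= D ->
  odd (count (door d) (pairs d)) = odd (count (rainbow d) (simplices d)).
Proof.
move=> dD; suff E s : {subset s <= simplices d} ->
    odd (count (door d) [seq (t, j) | t <- s, j <- iota 0 d.+1]) =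
    odd (count (rainbow d) s) by exact: E.
elim: s => [//|t s IHs] ts.
rewrite allpairs_cons [count (rainbow d) _]/= count_cat [LHS]oddD [RHS]oddD IHs; last first.
  by move=> u us; apply: ts; rewrite inE us orbT.
congr (_ (+) _); rewrite count_map.
have st : t \in simplices d by apply: ts; rewrite mem_head.
by rewrite /rainbow -odd_doors ?size_colours ?colours_le // oddb.
Qed.

(** Raising the corner along the first step and postponing that step to the end gives the same path
    started one vertex later. Hence the facet opposite to the first vertex of one simplex is the
    facet opposite to the last vertex of the other. *)
Lemma vert_rot x w a j : uniq (a :: w) -> j <= size w ->
  vert (incr_nth x a) (rcons w a) j = vert x (a :: w) j.+1.
Proof.
move=> /= /andP[aw _] jw; apply/funext => i; rewrite /vert nth_incr_nth /= inE.
rewrite -cats1 takel_cat //; have [<-|//] := eqVneq a i.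
rewrite (_ : (a \in _) = false) ?addn0 1?addnC //.
by apply: contraNF aw => /mem_take.
Qed.

Lemma rmnth_rot x w a : uniq (a :: w) ->
  rmnth (size w).+1 (colours (size w).+1 (incr_nth x a) (rcons w a)) =
  rmnth 0 (colours (size w).+1 x (a :: w)).
Proof.
move=> uw; rewrite /rmnth take0 cat0s drop_oversize ?size_colours // cats0.
rewrite /colours -map_take take_iota -map_drop drop_iota add0n.
rewrite (minn_idPl _) // subSS subn0 (iotaDl 1 0) -map_comp.
apply/eq_in_map => j; rewrite mem_iota add0n ltnS /= => jw.
by rewrite vert_rot.
Qed.

Lemma rmnth_swap x u v a b j d : j = (size u).+1 -> j <= d ->
  rmnth j (colours d x (u ++ a :: b :: v)) =
  rmnth j (colours d x (u ++ b :: a :: v)).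
Proof.
move=> jE jd; rewrite /rmnth -!map_take -!map_drop take_iota drop_iota.
have vE i : i != j -> vert x (u ++ a :: b :: v) i = vert x (u ++ b :: a :: v) i.
  move=> ij; apply/funext => k; rewrite /vert mem_take_swap //.
  by rewrite -jE.
congr (_ ++ _); apply/eq_in_map => i; rewrite mem_iota => /andP[h1 h2];
  rewrite vE //; lia.
Qed.

(* Maps a facet of a simplex to the same facet of the other simplex containing
   it; facets on the boundary of the cube are fixed. *)
Definition flip d (p : seq nat * seq nat * nat) :=
  let: (x, w, j) := p in
  if j == 0 then
    let a := head 0 w in
    if (nth 0 x a).+1 < m then (incr_nth x a, rot 1 w, d) else p
  else if j == d then
    let a := last 0 w in
    if 0 < nth 0 x a then (decr_nth x a, rotr 1 w, 0) else p
  else (x, swap j w, j).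

Lemma all_incr_nth x a : a < size x -> all (fun v => v < m) x ->
  (nth 0 x a).+1 < m -> all (fun v => v < m) (incr_nth x a).
Proof.
move=> ax /allP xm xa; apply/(all_nthP 0) => i.
rewrite size_incr_nth ax nth_incr_nth => ix.
by case: eqVneq => [<-//|_]; apply: xm; rewrite mem_nth.
Qed.

Lemma all_decr_nth x a : a < size x -> all (fun v => v < m) x ->
  all (fun v => v < m) (decr_nth x a).
Proof.
move=> ax /allP xm; apply/(all_nthP 0) => i.
rewrite size_set_nth (maxn_idPr _) // nth_set_nth /= => ix.
case: eqVneq => [_|_]; last by apply: xm; rewrite mem_nth.
by rewrite (leq_ltn_trans (leq_pred _)) // xm // mem_nth.
Qed.

Lemma mem_pairs d x w j : ((x, w, j) \in pairs d) =
  [&& size x == d, all (fun a => a < m) x, perm_eq w (iota 0 d) & j <= d].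
Proof.
have -> : [&& size x == d, all (fun a => a < m) x, perm_eq w (iota 0 d) & j <= d] =
    ((x, w) \in simplices d) && (j <= d) by rewrite mem_simplices -!andbA.
apply/allpairsP/andP => [[[t k] [td kd [xwt jk]]]|[td jd]].
  by move: td kd; rewrite mem_iota xwt jk.
by exists (x, w, j); rewrite mem_iota.
Qed.

(** The first and the last facet are exchanged by rotations inverse to each other, an inner swap
    undoes itself, and a boundary facet is fixed; the colours of the facet never change. *)
Lemma flip_door d p : 0 < d -> p \in pairs d -> door d p ->
  [/\ flip d p \in pairs d, door d (flip d p) & flip d (flip d p) = p].
Proof.
case: p => [[x w] j] d0; rewrite mem_pairs => /and4P[sx xm pw jd] dp.
have uw : uniq w by rewrite (perm_uniq pw) iota_uniq.
have sw : size w = d by rewrite (perm_size pw) size_iota.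
rewrite /flip; have [j0|j0] := eqVneq j 0.
  case: w pw uw sw dp => [|a w] pw uw sw dp; first by rewrite -sw in d0.
  have ax : a < size x.
    by rewrite (eqP sx) -[_ < _](mem_iota 0) -(perm_mem pw) mem_head.
  rewrite [head _ _]/= rot1_cons; case: ifPn => [xa|xa]; last first.
    by rewrite mem_pairs sx xm pw jd j0 /= (negPf xa) -j0.
  rewrite (gtn_eqF d0) eqxx last_rcons nth_incr_nth eqxx add1n ltn0Sn incr_nthK //.
  rewrite -rot1_cons rotK j0; split=> //.
    rewrite mem_pairs size_incr_nth ax sx all_incr_nth //= leqnn andbT.
    by rewrite rot1_cons perm_rcons.
  by move: dp; rewrite /door /= j0 rot1_cons -sw rmnth_rot // sw.
have [jd'|jd'] := eqVneq j d.
  subst j.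
  case/lastP: w pw uw sw dp => [|w a] pw uw sw dp; first by rewrite -sw in d0.
  have ax : a < size x.
    by rewrite (eqP sx) -[_ < _](mem_iota 0) -(perm_mem pw) mem_rcons mem_head.
  rewrite last_rcons; case: ifPn => [xa|xa]; last first.
    by rewrite mem_pairs sx xm pw jd (negPf j0) eqxx last_rcons (negPf xa).
  rewrite eqxx rotr1_rcons /= rot1_cons decr_nthK //.
  have xam : (nth 0 (decr_nth x a) a).+1 < m.
    rewrite nth_set_nth /= eqxx prednK //; exact: (allP xm _ (mem_nth 0 ax)).
  rewrite xam; split=> //.
    rewrite mem_pairs size_set_nth (maxn_idPr _) // sx all_decr_nth //= andbT.
    by rewrite -perm_rcons.
  move: dp; rewrite /door /= -sw size_rcons -rmnth_rot ?decr_nthK //.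
  by move: uw; rewrite rcons_uniq.
have [|u [v [a [b [wE jE]]]]] := @split_swap _ j w; first by rewrite sw; lia.
subst w; rewrite [in swap j _]jE swapE /= (negPf j0) (negPf jd') jE swapE -jE.
split=> //.
  rewrite mem_pairs sx xm jd andbT -(seq.permPl (_ : perm_eq (u ++ a :: b :: v) _)) //.
  by rewrite perm_cat2l -[a :: _]/([:: a] ++ [:: b] ++ v) perm_catCA.
by rewrite /door /= -(@rmnth_swap x u v a b j d).
Qed.

(** A simplex in the face x_d = 0 is the facet, opposite to the last vertex, of the simplex standing
    on it. *)
Lemma rmnth_rcons x w d : size w = d ->
  rmnth d.+1 (colours d.+1 (rcons x 0) (rcons w d)) = colours d x w.
Proof.
move=> sw; rewrite /rmnth drop_oversize ?size_colours // cats0.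
rewrite /colours -map_take take_iota (minn_idPl _) //.
apply/eq_in_map => j; rewrite mem_iota add0n ltnS /= => jd; congr c.
apply/funext => i; rewrite /vert nth_rcons -cats1 takel_cat ?sw //.
by case: ltnP => // ix; rewrite nth_default //; case: eqP.
Qed.

Lemma pairs_uniq d : uniq (pairs d).
Proof.
apply: allpairs_uniq; rewrite ?simplices_uniq ?iota_uniq //.
by move=> [t j] [u k] _ _.
Qed.

Lemma door_vert d x w j k : door d (x, w, j) -> k < d ->
  exists i, [/\ i <= d, i != j & c (vert x w i) = k].
Proof.
move=> /perm_mem/(_ k); rewrite mem_iota /= add0n => kE kd; move: kE; rewrite kd.
rewrite mem_cat /colours -map_take -map_drop take_iota drop_iota.
by case/orP => /mapP[i]; rewrite mem_iota => ii ->; exists i; split=> //; lia.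
Qed.

(* Among the facets on the boundary of the cube, only those on the face x_d = 0
   can carry all the colours 0 .. d. *)
Lemma flip_fixed d x w j : d < D -> (x, w, j) \in pairs d.+1 ->
  door d.+1 (x, w, j) -> flip d.+1 (x, w, j) = (x, w, j) ->
  exists t, [/\ t \in simplices d, rainbow d t &
    (x, w, j) = (rcons t.1 0, rcons t.2 d, d.+1)].
Proof.
move=> dD; rewrite mem_pairs => /and4P[/eqP sx xm pw jd] dp.
have ts : (x, w) \in simplices d.+1 by rewrite mem_simplices sx eqxx xm pw.
have uw : uniq w by rewrite (perm_uniq pw) iota_uniq.
have sw : size w = d.+1 by rewrite (perm_size pw) size_iota.
have wd a : a \in w -> a <= d by rewrite (perm_mem pw) mem_iota.
rewrite /flip; have [j0|j0] := eqVneq j 0.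
  case: w wd pw uw sw dp ts => [//|a w] wd pw uw sw dp ts.
  have ad : a <= d by rewrite wd // mem_head.
  rewrite [head _ _]/=; case: ifPn => [_ [_ _ j0']|]; first by rewrite -j0' in j0.
  have := allP xm _ (mem_nth 0 (_ : a < size x)); rewrite sx ltnS ad => /(_ isT) xa.
  rewrite -leqNgt => mx _.
  (* All vertices but the omitted first one have coordinate [a] equal to [m], so by [c_facem] none
     carries colour [a], which a door must show. *)
  have [i [id ij ci]] := door_vert dp (ad : a < d.+1).
  case: (@c_facem (vert x (a :: w) i) a) => //; first exact: leq_ltn_trans dD.
    exact: vert_le ts.
  case: i ij {id ci} => [|i]; first by rewrite j0.
  by rewrite /vert /= mem_head addn1 => _; apply/eqP; rewrite eqn_leq xa.
have [jd' |jd'] := eqVneq j d.+1; last first.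
  have [|u [v [a [b [wE jE]]]]] := @split_swap _ j w; first by rewrite sw; lia.
  rewrite wE jE swapE => -[] /eqP; rewrite eqseq_cat // eqxx /= => /eqP[ab _].
  by move: uw; rewrite wE cat_uniq /= !inE ab eqxx /= !andbF.
subst j; case/lastP: w wd pw uw sw dp ts => [//|w a] wd pw uw sw dp ts.
rewrite last_rcons; case: ifPn => [_ [] //|].
rewrite -leqNgt leqn0 => /eqP xa _.
have ad : a <= d by rewrite wd // mem_rcons mem_head.
have [i [id ij ci]] := door_vert dp (ltnSn d).
(* The facet lies in the face x_a = 0, where colours are at most [a], yet it shows the colour
   [d]. *)
have da : d <= a.
  rewrite -ci; apply: c_face0.
  - exact: leq_trans ad (ltnW dD).
  - exact: vert_le ts.
  rewrite /vert xa; move: sw uw; rewrite size_rcons rcons_uniq => -[sw] /andP[aw _].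
  rewrite -cats1 takel_cat ?sw; last by lia.
  by rewrite (_ : (a \in _) = false) //; apply: contraNF aw => /mem_take.
have {ad da} aE : a = d by apply/eqP; rewrite eqn_leq ad.
subst a; case/lastP: x sx xm xa dp {ts ci} => [//|x a].
rewrite size_rcons all_rcons nth_rcons => -[sx] /andP[am xm].
rewrite sx ltnn eqxx => aE; subst a => dp.
move: sw; rewrite size_rcons => -[sw].
exists (x, w); split=> //.
  rewrite mem_simplices sx eqxx xm /= -(perm_cons d).
  by rewrite -(seq.permPr (perm_iotaS d)) -perm_rcons.
by rewrite /rainbow -rmnth_rcons.
Qed.

(** Induction on [d]: [flip] pairs off the doors in dimension d + 1 except those on the face x_d =
    0, which are the rainbow simplices of dimension [d]. *)
Lemma odd_rainbow d : d <= D -> odd (count (rainbow d) (simplices d)).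
Proof.
elim: d => [_|d IHd dD].
  have v0 k : vert [::] [::] 0 k = 0 by rewrite /vert nth_nil.
  have := @c_face0 (vert [::] [::] 0) 0 (leq0n _) _ (v0 0).
  rewrite leqn0 => c0; rewrite /rainbow /= /colours /= (eqP (c0 _)) // => k.
  by rewrite v0.
rewrite -odd_count_doors // -size_filter (@odd_involution _ _ (flip d.+1)).
- rewrite -size_filter (_ : size _ = count (rainbow d) (simplices d)).
    by apply: IHd; exact: ltnW.
  rewrite -size_filter.
  rewrite -(size_map (fun t => (rcons t.1 0, rcons t.2 d, d.+1))).
  apply/perm_size/uniq_perm; rewrite ?filter_uniq ?pairs_uniq //.
    rewrite map_inj_uniq ?filter_uniq ?simplices_uniq //.
    by move=> [x w] [y v] [] /= /rcons_inj[->] /rcons_inj[->].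
  move=> [[x w] j]; rewrite !mem_filter; apply/and3P/mapP.
    move=> [/eqP fp dp pp]; have [t [ts rt ->]] := flip_fixed dD pp dp fp.
    by exists t; rewrite // mem_filter rt.
  move=> [[y v]]; rewrite mem_filter mem_simplices => /and4P[rt /eqP sy ym pv] [-> -> ->].
  have sv : size v = d by rewrite (perm_size pv) size_iota.
  split=> /=.
  - by rewrite eqxx last_rcons nth_rcons sy ltnn eqxx.
  - by rewrite /door /= rmnth_rcons.
  - rewrite mem_pairs size_rcons sy eqxx all_rcons m_gt0 ym leqnn andbT.
    by rewrite perm_rcons (seq.permPr (perm_iotaS d)) perm_cons pv.
- by rewrite filter_uniq ?pairs_uniq.
- by move=> p; rewrite !mem_filter => /andP[dp pp]; have [-> ->] := flip_door (ltn0Sn d) pp dp.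
- by move=> p; rewrite !mem_filter => /andP[dp pp]; have [] := flip_door (ltn0Sn d) pp dp.
Qed.

Lemma kuhn : exists v : nat -> nat -> nat,
  [/\ forall j k, v j k <= m, forall j k, (v 0 k <= v j k <= (v 0 k).+1)
    & forall i, i <= D -> exists j, c (v j) = i].
Proof.
have /hasP[[x w] ts rt] : has (rainbow D) (simplices D).
  by rewrite has_count; apply: odd_gt0; exact: odd_rainbow.
exists (vert x w); split.
- by move=> j k; exact: vert_le ts _.
- by move=> j k; rewrite /vert take0 in_nil addn0 leq_addr -addn1 leq_add2l leq_b1.
move=> i iD; have : i \in iota 0 D.+1 by rewrite mem_iota.
by rewrite -(perm_mem rt) => /mapP[j _ ->]; exists j.
Qed.

End Kuhn.

Local Open Scope classical_set_scope.
Local Open Scope ring_scope.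

(** * Lebesgue numbers and the order of a cover *)

(** The near-covering form of compactness, applied to radii tending to 0, yields one radius for all
    points of [A]. *)
Lemma lebesgue_number (R : realType) (T : topologicalType) (rho : T -> T -> R)
    (A : set T) (I : Type) (O : I -> set T) :
  compatible_metric rho -> compact A ->
  (forall x, A x -> exists i, nbhs x (O i)) ->
  exists2 e : R, 0 < e & forall x, A x -> exists i, forall y, rho x y < e -> O i y.
Proof.
move=> rhoC /compact_near_coveringP cA AO.
pose P (e : R) (x : T) := exists i, forall y, rho x y < e -> O i y.
have : \forall e \near 0^'+, A `<=` P e.
  apply: (cA R 0^'+ P _) => x /AO[i /(rho_nbhs rhoC)[r r0 rO]].
  (* The two halves of [r] leave room for the triangle inequality. *)
  exists ([set y | rho x y < r / 2], [set e | e < r / 2]); rewrite /=.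
    split; first by apply/(rho_nbhs rhoC); exists (r / 2); rewrite ?divr_gt0.
    by apply: nbhs_right_lt; rewrite divr_gt0.
  move=> [y e] /= [xy er]; exists i => z yz; apply: rO => /=.
  have := rho_triangle rhoC x y z; lra.
move=> AP; have [e [APe e0]] : exists e, A `<=` P e /\ 0 < e.
  near (0:R)^'+ => e; exists e; split; near: e => //.
  exact: nbhs_right_gt.
by exists e.
Unshelve. all: by end_near. Qed.

(** Along an ultrafilter every coordinate converges in [0,1], a cluster point being a limit, and the
    vanishing products pass to the limit. *)
Lemma hardcore_compact (R : realType) : compact [set: hardcore R].
Proof.
rewrite compact_ultra => F UF _.
have FF : ProperFilter F by exact: ultra_proper.
have lim g : exists l : R, 0 <= l <= 1 /\ (fun y : hardcore R => hc_val y g) @ F --> l.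
  pose f (y : hardcore R) := hc_val y g.
  have [|l [/= l01 Fl]] := @segment_compact R 0 1 (f @ F) _.
    rewrite /fmap /=; apply: (@filterS _ F _ setT) filterT => y _ /=.
    by have [/(_ g)] := set_mem (valP y); rewrite in_itv.
  exists l; split; first by move: l01; rewrite in_itv.
  move=> A lA; have [//|FnA] := in_ultra_setVsetC (f @^-1` A) UF.
  by have [z []] := Fl (~` A) A FnA lA.
have [l lP] := choice lim.
have lhc : l \in @hc_set R.
  apply/mem_set; split=> [g|g s]; first by have [] := lP g.
  have [_ lg] := lP g; have [_ lgs] := lP (g * gen s)%g.
  apply: (@cvg_unique _ (@Rhausdorff R) ((fun y : hardcore R =>
    hc_val y g * hc_val y (g * gen s)%g) @ F) _); first exact: cvgM.
  apply: cvg_near_cst; apply: filterS filterT => y _.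
  by have [_ ->] := set_mem (valP y).
exists (exist _ l lhc : hardcore R); split=> //=.
by apply: cvg_hc_coord => g; have [] := lP g.
Qed.

Section Order.
Variables (R : realType) (Y : topologicalType).

Lemma sum_indic (gamma : set (set Y)) (y : Y) : finite_set gamma ->
  \sum_(U \in gamma) (\1_U y : R) =
  (size [seq U <- finmap.enum_fset (fset_set gamma) | y \in U])%:R.
Proof.
move=> fg; rewrite fsbig_finite // size_filter -sum1_count natr_sum [RHS]big_mkcond.
by apply: eq_bigr => U _; rewrite indicE; case: ifP.
Qed.

(** An injective rank with values in 0, ..., k leaves at most k + 1 members through [y], and [ord]
    subtracts 1. *)
Lemma ord_le (gamma : set (set Y)) (r : R) : finite_set gamma ->
  (forall y, exists k (rank : set Y -> nat),
    [/\ k%:R <= r, forall U, gamma U -> U y -> (rank U <= k)%N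
      & forall U W, gamma U -> U y -> gamma W -> W y -> rank U = rank W -> U = W]) ->
  (ord R gamma <= r%:E)%E.
Proof.
move=> fg gk; apply: ge_ereal_sup => _ [y _ <-].
have [k [rank [kr rk rinj]]] := gk y.
rewrite lee_fin sum_indic // lerBlDr (le_trans _ (lerD kr (lexx 1))) // natr1 ler_nat.
set s := [seq _ <- _ | _].
have sE U : U \in s -> gamma U /\ U y.
  by rewrite mem_filter in_fset_set // => /andP[/set_mem ? /set_mem].
rewrite -(size_map rank) -(size_iota 0 k.+1); apply: uniq_leq_size.
  rewrite map_inj_in_uniq ?filter_uniq ?finmap.fset_uniq // => U W /sE[gU Uy] /sE[gW Wy].
  exact: rinj.
move=> _ /mapP[U /sE[gU Uy] ->]; rewrite mem_iota add0n ltnS /=; exact: rk.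
Qed.

Lemma ord_ge (gamma : set (set Y)) (y : Y) d (L : nat -> set Y) : finite_set gamma ->
  (forall i, (i <= d)%N -> gamma (L i) /\ L i y) ->
  (forall i j, (i <= d)%N -> (j <= d)%N -> L i = L j -> i = j) ->
  (d%:R%:E <= ord R gamma)%E.
Proof.
move=> fg Ly Linj.
apply: (@le_trans _ _ (\sum_(U \in gamma) (\1_U y : R) - 1)%:E); last first.
  by apply: ereal_sup_ubound; exists y.
rewrite lee_fin sum_indic // lerBrDr natr1 ler_nat.
rewrite -{1}(size_iota 0 d.+1) -(size_map L); apply: uniq_leq_size.
  rewrite map_inj_in_uniq ?iota_uniq // => i j.
  rewrite !mem_iota !add0n !ltnS /= => id jd; exact: Linj.
move=> _ /mapP[i + ->]; rewrite mem_iota add0n ltnS /= => /Ly[gL Lyy].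
by rewrite mem_filter in_fset_set // !mem_set.
Qed.

End Order.

(** * Lebesgue's covering theorem *)

Lemma compatible_metric_rV (R : realType) d :
  compatible_metric (fun x y : 'rV[R]_d => `|x - y|).
Proof.
split=> // [x y|x y|x y z|x A].
- by split=> [/eqP|->]; rewrite ?subrr ?normr0 // normr_eq0 subr_eq0 => /eqP.
- exact: distrC.
- exact: ler_distD.
- exact: (nbhs_normP x A).
Qed.

(* The colour of a member B of the cover is the first i such that B misses the
   face y_i = 1, or d if there is none. *)
Lemma lebesgue_covering (R : realType) (Y : topologicalType) (d : nat)
    (Psi : 'rV[R]_d -> Y) (beta : set (set Y)) :
  continuous Psi -> fin_open_cover beta ->
  (forall B (i : 'I_d), beta B -> (forall y, B (Psi y) -> y 0 i <> 0) \/
                                  (forall y, B (Psi y) -> y 0 i <> 1)) ->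
  (d%:R%:E <= ord R beta)%E.
Proof.
move=> cPsi [fb ob cb] faces.
pose A := [set y : 'rV[R]_d | forall i, `[0, 1]%classic (y ord0 i)].
pose O B := [set y | beta B /\ B (Psi y)].
have cA : compact A.
  by apply: (@rV_compact R d (fun=> `[0, 1]%classic)) => i; exact: segment_compact.
have [|e e0 eO] := lebesgue_number (O := O) (compatible_metric_rV R d) cA.
  move=> y _; have [B bB By] : (\bigcup_(U in beta) U) (Psi y) by rewrite cb.
  exists B; have : nbhs y (Psi @^-1` B) by apply: cPsi; apply: open_nbhs_nbhs; split; [exact: ob|].
  by apply: filterS => z Bz; split.
(* The grid of mesh 1/(n+1) < e puts every vertex of a small simplex in the [e]-ball about its
   corner. *)
have [n _ /(_ n (leqnn n)) /= ne] := near_infty_natSinv_lt (PosNum e0).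
pose P (k : nat -> nat) : 'rV[R]_d := \row_i ((k i)%:R / n.+1%:R).
have /choice[L LP] : forall k : nat -> nat, exists B, (forall i, (k i <= n.+1)%N) ->
    beta B /\ forall y, `|P k - y| < e -> B (Psi y).
  move=> k; have [kn|nk] := pselect (forall i, (k i <= n.+1)%N); last by exists set0.
  have [|B eB] := eO (P k).
    by move=> i /=; rewrite mxE in_itv /= divr_ge0 // ler_pdivrMr // mul1r ler_nat kn.
  exists B => _; split=> [|y /eB[]//].
  by have [] := eB (P k); rewrite // subrr normr0.
pose low B i := forall (j : 'I_d) y, j = i :> nat -> B (Psi y) -> y 0 j <> 1.
pose col B := find (fun i => `[< low B i >]) (iota 0 d).
have LPk k : (forall i, (k i <= n.+1)%N) -> L k (Psi (P k)).
  by move=> kn; have [_] := LP k kn; apply; rewrite subrr normr0.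
have [||v [vn v01 vcol]] := @kuhn n.+1 d (col \o L) isT.
(* The member [L k] meets the face y_i = 0, so it must miss y_i = 1, and its colour is at most
   [i]. *)
- move=> k i id kn ki /=; rewrite leqNgt; apply/negP => ikc.
  have id' : (i < d)%N by rewrite (leq_trans ikc) // -[X in (_ <= X)%N](size_iota 0 d) find_size.
  have := before_find 0%N ikc; rewrite nth_iota // add0n => /asboolP; apply.
  move=> j y ji; have [bL _] := LP k kn.
  case: (faces _ j bL) => [/(_ _ (LPk k kn))|]; last exact.
  by rewrite mxE ji ki mul0r.
(* Colour [i < d] means that [L k] misses y_i = 1, where [P k] lies. *)
- move=> k i id kn ki /= ci.
  have /(nth_find 0%N) : has (fun i => `[< low (L k) i >]) (iota 0 d).
    by rewrite has_find size_iota -/(col (L k)) ci.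
  rewrite -/(col (L k)) ci nth_iota // add0n => /asboolP /(_ (Ordinal id) (P k) erefl (LPk k kn)).
  by rewrite mxE /= ki divff // pnatr_eq0.
have /choice[J JP] : forall i, exists j, (i <= d)%N -> col (L (v j)) = i.
  move=> i; have [/vcol[j <-]|di] := leqP i d; first by exists j.
  by exists 0%N.
(* The members at the vertices of a rainbow simplex are distinct, having distinct colours, and all
   contain the image of its corner. *)
apply: (@ord_ge _ _ _ (Psi (P (v 0%N))) d (fun i => L (v (J i)))) => //.
- move=> i id; have [bL eL] := LP (v (J i)) (vn (J i)); split=> //; apply: eL.
  rewrite [X in X < _]mx_normrE; apply: bigmax_lt => // -[r j] _ /=.
  rewrite !mxE -mulrBl normrM [X in _ * X]ger0_norm ?invr_ge0 //.
  apply: le_lt_trans ne; rewrite ler_piMl ?invr_ge0 //.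
  have /andP[v0 v1] := v01 (J i) j.
  by rewrite ger0_norm ?subr_ge0 ?ler_nat // lerBlDl natr1 ler_nat.
- by move=> i j id jd E; rewrite -(JP i id) -(JP j jd) E.
Qed.

(** * Lower bound *)

Lemma cvg_set_val (T : topologicalType) (A : set T) (F : set_system A) (x : A)
    {FF : Filter F} :
  (@set_val _ A) @ F --> set_val x -> F --> x.
Proof.
move=> Fx C; rewrite nbhsE => -[_ [[B oB <-] Bx] /filterS]; apply.
exact/Fx/open_nbhs_nbhs.
Qed.

Lemma cvg_ptws (V : finType) (X : topologicalType) (F : set_system {ptws V -> X})
    (f : {ptws V -> X}) {FF : Filter F} :
  (forall v, (fun h : {ptws V -> X} => h v) @ F --> f v) -> F --> f.
Proof.
move=> Ff; apply/cvg_sup => v C; rewrite (@nbhsE (initial_topology _)).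
move=> [_ [[D oD <-] Dx] DC]; apply: (filterS DC).
by apply/Ff/open_nbhs_nbhs.
Qed.

Lemma perm_hom1 (G : groupType) (V : finType) (sigma : G -> {perm V}) v :
  perm_hom sigma -> sigma 1%g v = v.
Proof. by move=> hom; apply: (@perm_inj _ (sigma 1%g)); rewrite -hom mulg1. Qed.

Lemma perm_homVK (G : groupType) (V : finType) (sigma : G -> {perm V}) g v :
  perm_hom sigma -> sigma g (sigma g^-1%g v) = v.
Proof. by move=> hom; rewrite -hom mulgV perm_hom1. Qed.

(** Clipping extends the microstates continuously from the cube to all row vectors, the domain
    required by [lebesgue_covering]. *)
Definition clip (R : realType) (r : R) : R := Num.max 0 (Num.min 1 r).

(** Each of the two sets misses one end of the interval [0,1]. *)
Definition site_cover (R : realType) : set (set (hardcore R)) :=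
  [set [set x | hc_val x 1%g < 1]; [set x | 0 < hc_val x 1%g]].

Lemma site_cover_open (R : realType) : fin_open_cover (@site_cover R).
Proof.
split.
- exact: finite_set2.
- move=> _ [|] ->.
    apply: (@open_comp _ _ (fun x : hardcore R => hc_val x 1%g) [set r : R | r < 1]);
      last exact: open_lt.
    by move=> x _; exact: hc_coord_continuous.
  apply: (@open_comp _ _ (fun x : hardcore R => hc_val x 1%g) [set r : R | 0 < r]);
    last exact: open_gt.
  by move=> x _; exact: hc_coord_continuous.
- rewrite -subTset => x _; have [x1|x1] := ltP (hc_val x 1%g) 1.
    by exists [set x | hc_val x 1%g < 1] => //; left.
  by exists [set x | 0 < hc_val x 1%g]; [right|exact: lt_le_trans x1].
Qed.

(** * Cubes inside the spaces of microstates *)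

Section Embedding.
Variables (R : realType) (V : finType) (sigma : F2 -> {perm V}).
Hypothesis hom : perm_hom sigma.
Variable I : {set V}.
Hypothesis indI : @independent (action_graph sigma) I.

Definition weight (y : 'rV[R]_#|I|) (u : V) : R :=
  if [pick i : 'I_#|I| | enum_val i == u] is Some i then clip (y 0 i) else 0.

Lemma weight_itv y u : 0 <= weight y u <= 1.
Proof.
rewrite /weight /clip; case: pickP => [i _|_]; last by rewrite lexx ler01.
by rewrite le_max lexx /= ge_max ler01 ge_min lexx.
Qed.

Lemma weight_notin y u : u \notin I -> weight y u = 0.
Proof.
rewrite /weight; case: pickP => // i /eqP <- /negP[]; exact: enum_valP.
Qed.

Lemma weight_val y i : weight y (enum_val i) = clip (y 0 i).
Proof.
rewrite /weight; case: pickP => [j /eqP /enum_val_inj -> //|/(_ i) /eqP].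
by case.
Qed.

Lemma weight_continuous u : continuous (weight ^~ u).
Proof.
rewrite /weight; case: pickP => [i _|_] y; last first.
  exact: cst_continuous.
have ci : (fun z : 'rV[R]_#|I| => z 0 i) @ y --> y 0 i by exact: coord_continuous.
have ci' : {for y, continuous (fun z : 'rV[R]_#|I| => (z 0 i : R^o))} by exact: ci.
have c1 : {for y, continuous ((cst 1 : 'rV[R]_#|I| -> R^o) \min (fun z => z 0 i))}.
  by apply: continuous_min => //; exact: cst_continuous.
have := @continuous_max _ _ (cst 0) _ y (@cst_continuous _ _ (0 : R^o) y) c1.
exact.
Qed.

Definition config (y : 'rV[R]_#|I|) (v : V) : {ptws F2 -> R} :=
  fun g => weight y (sigma g^-1%g v).

(** The entries at g and gs are the weights of u and s^-1 u, which an edge joins; at least one of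
    these vertices is outside [I]. *)
Lemma config_hc y v : config y v \in @hc_set R.
Proof.
apply/mem_set; split=> [g|g s]; first exact: weight_itv.
rewrite /config invgM hom; set u := sigma g^-1%g v.
have [uI|/weight_notin ->] := boolP (u \in I); last by rewrite mul0r.
rewrite [X in _ * X]weight_notin ?mulr0 //; apply/negP => su.
move/forallP/(_ (sigma (gen s)^-1%g u, s)): indI.
by rewrite /= perm_homVK // uI su.
Qed.

Definition microstate (y : 'rV[R]_#|I|) : {ptws V -> hardcore R} :=
  fun v => exist _ (config y v) (config_hc y v).

Lemma microstate_equivariant y g v :
  microstate y (sigma g v) = hc_shift g (microstate y v).
Proof.
apply/val_inj/funext => h.
change (weight y (sigma h^-1%g (sigma g v)) = weight y (sigma (g^-1 * h)^-1%g v)).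
by rewrite invgM invgK hom.
Qed.

Variable rho : hardcore R -> hardcore R -> R.
Hypothesis rhoC : compatible_metric rho.

Lemma microstate_Map F delta y : 0 < delta ->
  microstate y \in Map (@hc_shift R) rho F delta sigma.
Proof.
move=> d0; apply/mem_set => g _; rewrite /rho2 big1 ?mulr0 ?sqrtr0 ?ltW // => v _.
by rewrite microstate_equivariant ((rho_eq0 rhoC _ _).2 erefl) expr0n.
Qed.

Lemma Dmap_ge_card F delta : 0 < delta ->
  (#|I|%:R%:E <= Dmap (@hc_shift R) rho (@site_cover R) F delta sigma)%E.
Proof.
move=> d0; apply: le_ereal_inf_tmp => _ [beta [cb rb] <-].
pose Psi y : Map (@hc_shift R) rho F delta sigma := 
  exist (fun phi => phi \in _) (microstate y) (microstate_Map F y d0).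
apply: (lebesgue_covering (Psi := Psi)) => //.
  move=> y; have FPsi : Filter (Psi @ y) by exact: (fmap_filter Psi (nbhs_filter y)).
  apply: (@cvg_set_val _ _ _ (Psi y) FPsi).
  apply: (@cvg_ptws V (hardcore R) _ (microstate y) (@fmap_filter _ _ _ _ FPsi)) => v.
  apply: (@cvg_hc_coord _ _ (microstate y v)) => g.
  exact: weight_continuous.
move=> B i bB; have [_ [_ [W WU <-] <-] BW] := rb _ bB.
have key y : B (Psi y) -> W (enum_val i) (microstate y (enum_val i)).
  by move=> /BW; exact.
have mE y : hc_val (microstate y (enum_val i)) 1%g = clip (y 0 i).
  change (weight y (sigma 1^-1%g (enum_val i)) = clip (y 0 i)).
  by rewrite invg1 perm_hom1 // weight_val.
(* The set {x_e < 1} excludes y_i = 1, and {x_e > 0} excludes y_i = 0. *)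
case: (WU (enum_val i)) => WE; [right|left] => y /key;
  rewrite WE /= mE /clip => + yi; rewrite yi.
  by rewrite minxx (max_idPr ler01) ltxx.
by rewrite (min_idPr ler01) maxxx ltxx.
Qed.

End Embedding.

(** * Upper bound *)

Section GridCover.
Variables (R : realType) (Y : topologicalType) (I : finType) (z : I -> Y -> R).
Variables (m c : nat) (r : R).
Hypothesis z_cont : forall i, continuous (z i).
Hypothesis z_itv : forall i p, 0 <= z i p <= m%:R.
Hypothesis z_off : forall p, #|[set i | z i p != c%:R]%SET|%:R <= r.

(* The cells of a barycentric subdivision of the unit grid: the coordinates in S
   lie strictly between consecutive integers and are all farther from the
   integers than the remaining ones. The sets S of the cells through a given
   point therefore form a chain, and they contain only noninteger
   coordinates. *)
Definition near_face (S : {set I}) (l : I -> nat) i p :=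
  if i \in S then (l i)%:R < z i p < (l i)%:R + 1
  else `|z i p - (l i)%:R| < 2^-1.

Definition closer (l : I -> nat) i j p :=
  `|z j p - (l j)%:R| < Num.min (z i p - (l i)%:R) ((l i)%:R + 1 - z i p).

Definition cell (S : {set I}) (l : I -> nat) : set Y :=
  [set p | forall i, near_face S l i p /\
           forall j, i \in S -> j \notin S -> closer l i j p].

Lemma near_lt (f g : Y -> R) p : continuous f -> continuous g -> f p < g p ->
  \forall q \near p, f q < g q.
Proof.
move=> cf cg fg; have : (fun q => g q - f q) @ p --> g p - f p.
  by apply: cvgB; [exact: cg|exact: cf].
move/cvgr_gt => /(_ 0); rewrite subr_gt0 => /(_ fg).
by apply: filterS => q; rewrite subr_gt0.
Qed.

Lemma cell_open S l : open (cell S l).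
Proof.
rewrite openE => p pS; rewrite /interior.
have cst_ (a : R) : continuous (fun _ : Y => a) by exact: cst_continuous.
have cz i (a : R) : continuous (fun q => z i q - a).
  by move=> q; apply: cvgB; [exact: z_cont|exact: cvg_cst].
have cz' i (a : R) : continuous (fun q => a - z i q).
  by move=> q; apply: cvgB; [exact: cvg_cst|exact: z_cont].
have czn i (a : R) : continuous (fun q => `|z i q - a|).
  by move=> q; apply: cvg_norm; exact: cz.
apply: filter_forall => i; have [pi pij] := pS i.
apply: filterI.
  move: pi; rewrite /near_face; case: ifP => _.
    by move=> /andP[p1 p2]; near=> q; apply/andP; split; near: q; exact: near_lt.
  exact: near_lt.
apply: filter_forall => j.
have [iS|iS] := boolP (i \in S); last by apply: nearW => q.
have [jS|jS] := boolP (j \in S); first by apply: nearW => q.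
have := pij j iS jS; rewrite /closer lt_min => /andP[p1 p2].
by near=> q; move=> _ _; rewrite lt_min; apply/andP; split; near: q; exact: near_lt.
Unshelve. all: by end_near. Qed.

(** The left side is the distance from [x] to the integers. *)
Lemma min_dist_nat (x : R) (l l' : nat) : l%:R < x < l%:R + 1 ->
  Num.min (x - l%:R) (l%:R + 1 - x) <= `|x - l'%:R|.
Proof.
move=> /andP[lx xl]; have [ll|ll] := leqP l' l.
  have : l'%:R <= l%:R :> R by rewrite ler_nat.
  by move=> ?; rewrite ge_min ger0_norm ?lerD2l ?lerN2; lra.
have : l%:R + 1 <= l'%:R :> R by rewrite natr1 ler_nat.
by move=> ?; rewrite ge_min ler0_norm; lra.
Qed.

(** Were i in S \ S' and j in S' \ S, one cell would put coordinate i farther from the integers than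
    j, and the other cell the converse. *)
Lemma cell_face_eq S S' l l' p : cell S l p -> cell S' l' p -> #|S| = #|S'| -> S = S'.
Proof.
move=> cS cS' SS'; apply/eqP; rewrite eqEcard SS' leqnn andbT.
apply: contraT => /subsetPn[i iS iS'].
have /subsetPn[j jS' jS] : ~~ (S' \subset S).
  apply: contraNN iS' => S'S; have /eqP -> // : S' == S.
  by rewrite eqEcard S'S SS' leqnn.
have [pi /(_ j iS jS) cij] := cS i; have [pj /(_ i jS' iS') cji] := cS' j.
move: pi pj; rewrite /near_face iS jS' => /(min_dist_nat (l' i)) hi /(min_dist_nat (l j)) hj.
have := lt_le_trans (lt_le_trans (lt_le_trans cij hi) (ltW cji)) hj.
by rewrite ltxx.
Qed.

(** For fixed [S] each coordinate ranges over an open interval of length 1, and different labels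
    shift it by integers, so these intervals are disjoint. *)
Lemma cell_label_eq S l l' p : cell S l p -> cell S l' p -> l = l'.
Proof.
move=> cS cS'; apply/funext => i.
suff lt1 a b : cell S a p -> cell S b p -> (a i <= b i)%N.
  by apply/eqP; rewrite eqn_leq !lt1.
move=> /(_ i)[+ _] /(_ i)[+ _]; rewrite /near_face -ltnS -(ltr_nat R) -[(b i).+1%:R]natr1.
case: ifP => _; first by move=> /andP[? ?] /andP[? ?]; lra.
rewrite !ltr_norml => /andP[? ?] /andP[? ?]. lra.
Qed.

Lemma cell_card S l p : cell S l p -> (#|S| <= #|[set i | z i p != c%:R]%SET|)%N.
Proof.
move=> cS; apply/subset_leq_card/fintype.subsetP => i iS; rewrite inE.
have [+ _] := cS i; rewrite /near_face iS => zi; apply/negP => /eqP zE.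
have := min_dist_nat c zi; rewrite zE subrr normr0 ge_min.
by move: zi; rewrite zE => /andP[? ?] /orP[?|?]; lra.
Qed.

Lemma cell_cover p : exists S (l : {ffun I -> 'I_m.+1}), cell S (fun i => l i) p.
Proof.
pose n i := Num.truncn (z i p + 2^-1).
have nP i : (n i)%:R <= z i p + 2^-1 < (n i).+1%:R.
  by apply: truncn_itv; have /andP[z0 _] := z_itv i p; rewrite addr_ge0 // invr_ge0.
(* The half-integer coordinates lie at distance exactly 1/2 from the integers, all others strictly
   nearer. For them [n i] is the upper neighbour, whence the correction by 1 in [l]. *)
pose S := [set i | z i p + 2^-1 == (n i)%:R]%SET.
pose l i := (n i - (i \in S))%N.
have lm i : (l i < m.+1)%N.
  rewrite ltnS (leq_trans (leq_subr _ _)) // -ltnS -(ltr_nat R) -[m.+1%:R]natr1.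
  have /andP[n1 _] := nP i; have /andP[_ zm] := z_itv i p; lra.
have inS i : i \in S -> z i p = (l i)%:R + 2^-1.
  move=> iS; have := iS; rewrite inE => /eqP zi; rewrite /l iS.
  have n0 : (0 < n i)%N.
    rewrite lt0n; apply/eqP => n0; move: zi; rewrite n0 mulr0n {n0} => zi.
    have /andP[z0 _] := z_itv i p; lra.
  by rewrite natrB // -zi mulr1n; lra.
have notS i : i \notin S -> `|z i p - (l i)%:R| < 2^-1.
  move=> iS; have := iS; rewrite inE => zi; rewrite /l (negPf iS) subn0.
  have /andP[n1 n2] := nP i; rewrite -[(n i).+1%:R]natr1 in n2.
  have n1' : (n i)%:R < z i p + 2^-1 by rewrite lt_neqAle eq_sym zi.
  rewrite ltr_norml; apply/andP; split; lra.
exists S, [ffun i => Ordinal (lm i)] => i.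
split; rewrite /near_face ?ffunE /=.
  case: ifPn => [/inS ->|/notS//]; apply/andP; split; lra.
move=> j /inS zi /notS zj; rewrite /closer !ffunE /= zi; apply: lt_le_trans zj _.
by rewrite le_min; apply/andP; split; lra.
Qed.

Lemma cell_small S l p q i : cell S l p -> cell S l q -> `|z i p - z i q| < 1.
Proof.
move=> /(_ i)[+ _] /(_ i)[+ _]; rewrite /near_face; case: ifP => _.
  by move=> /andP[? ?] /andP[? ?]; rewrite ltr_norml; apply/andP; split; lra.
rewrite !ltr_norml => /andP[? ?] /andP[? ?]; apply/andP; split; lra.
Qed.

Lemma grid_cover : exists beta : set (set Y),
  [/\ fin_open_cover beta, (ord R beta <= r%:E)%E &
    forall B, beta B -> forall p q i, B p -> B q -> `|z i p - z i q| < 1].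
Proof.
pose f (Sl : {set I} * {ffun I -> 'I_m.+1}) := cell Sl.1 (fun i => Sl.2 i).
exists (range f).
have fin : finite_set (range f) by apply/finite_image/finite_finset.
split.
- split=> // [_ [Sl _ <-]|]; first exact: cell_open.
  rewrite -subTset => p _; have [S [l Sl]] := cell_cover p.
  by exists (cell S (fun i => l i)) => //; exists (S, l).
- apply: ord_le => // p.
  have /choice[rep repP] : forall U, exists Sl, range f U -> f Sl = U.
    move=> U; have [[Sl _ <-]|nU] := pselect (range f U); first by exists Sl.
    by exists (finset.set0, [ffun _ => ord0]).
  (* Cells through one point are ranked by the size of their [S], which by [cell_face_eq] and
     [cell_label_eq] determines the cell. *)
  exists #|[set i | z i p != c%:R]%SET|, (fun U => #|(rep U).1|); split=> //.
    by move=> U gU; rewrite -{1}(repP _ gU); exact: cell_card.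
  move=> U W gU + gW; rewrite -{1}(repP _ gU) -{1}(repP _ gW) => pU pW UW.
  rewrite -(repP _ gU) -(repP _ gW) /f.
  have SE := cell_face_eq pU pW UW; rewrite /f SE in pU *.
  by rewrite (cell_label_eq pU pW).
- by move=> _ [[S l] _ <-] p q i; exact: cell_small.
Qed.

End GridCover.

(** * Uniform continuity, thresholding and a Markov bound *)

Lemma uniform_modulus (R : realType) (T : topologicalType) (rho : T -> T -> R)
    (f : T -> R) (e : R) :
  compatible_metric rho -> compact [set: T] -> continuous f -> 0 < e ->
  exists2 d : R, 0 < d & forall x y, rho x y < d -> `|f x - f y| < e.
Proof.
move=> rhoC cT cf e0.
have [|d d0 dP] := lebesgue_number (O := fun x => [set y | `|f x - f y| < e / 2]) rhoC cT.
  move=> x _; exists x; have /cvgrPdist_lt := cf x.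
  by apply; rewrite divr_gt0.
exists d => // x y xy; have [c cP] := dP x I.
have := cP y xy; have := cP x; rewrite ((rho_eq0 rhoC _ _).2 erefl) => /(_ d0) /= cx cy.
have := ler_distD (f c) (f x) (f y); rewrite (distrC (f x) (f c)); lra.
Qed.

(** In [hc_metric] the coordinates numbered [n] or later contribute less than half the Lebesgue
    number, so finitely many coordinates decide. *)
Lemma hardcore_coord_lebesgue (R : realType) (U : set (set (hardcore R))) :
  fin_open_cover U -> exists (e : R) (gs : seq F2), 0 < e /\
  forall x, exists2 W, U W & forall y,
    (forall g, g \in gs -> `|hc_val x g - hc_val y g| <= e) -> W y.
Proof.
move=> [_ oU cU].
have [|e e0 eP] := lebesgue_number (O := fun W => [set y | U W /\ W y])
    (@hc_metric_compatible R) (@hardcore_compact R).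
  move=> x _; have [W UW Wx] : (\bigcup_(W in U) W) x by rewrite cU.
  exists W; have : nbhs x W by apply: open_nbhs_nbhs; split; [exact: oU|].
  by apply: filterS => y Wy; split.
have e20 : 0 < e / 2 by rewrite divr_gt0.
have [n _ nP] := near_infty_natSinv_lt (PosNum e20).
exists (e / 2), (pmap (@choice.unpickle F2) (iota 0 n)); split=> // x.
have [W WP] := eP x I; exists W.
  by have [] := WP x; rewrite // ((rho_eq0 (@hc_metric_compatible R) _ _).2 erefl).
move=> y xy; have [] // := WP y.
apply: (@le_lt_trans _ _ (e / 2)); last by lra.
apply: hc_metric_le => g; have [gn|ng] := ltnP (choice.pickle g) n.
  rewrite /hc_gap (le_trans _ (xy g _)) //.
    by rewrite ler_piMl // invf_le1 // ler1n.
  by rewrite mem_pmap; apply/mapP; exists (choice.pickle g); rewrite ?mem_iota // choice.pickleK.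
by apply: le_trans (ltW (nP _ ng)); rewrite /hc_gap ler_piMr // hc_dist_le1.
Qed.

(** [x] minus its projection to [-t, t]: a continuous substitute for setting small values to 0. *)
Definition soft (R : realType) (t x : R) : R := x - Num.max (- t) (Num.min t x).

Lemma soft_continuous (R : realType) (t : R) : continuous (soft t).
Proof.
move=> x; apply: cvgB; first exact: cvg_id.
have c1 : {for x, continuous ((cst t : R -> R^o) \min (fun y => y))}.
  by apply: continuous_min => //; exact: cst_continuous.
by have := @continuous_max _ _ (cst (- t)) _ x (@cst_continuous _ _ (- t : R^o) x) c1.
Qed.

Lemma soft_near (R : realType) (t x : R) : 0 <= t -> `|soft t x - x| <= t.
Proof.
move=> t0; rewrite /soft ler_norml.
have [tx|tx] := leP t x; first by rewrite max_r; lra.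
by have [tx'|tx'] := leP (- t) x; apply/andP; split; lra.
Qed.

Lemma soft_le1 (R : realType) (t x : R) : 0 <= t -> `|x| <= 1 -> `|soft t x| <= 1.
Proof.
move=> t0; rewrite /soft !ler_norml => /andP[x1 x2].
have [tx|tx] := leP t x; first by rewrite max_r; lra.
by have [tx'|tx'] := leP (- t) x; apply/andP; split; lra.
Qed.

Lemma soft_eq0 (R : realType) (t x : R) : `|x| <= t -> soft t x = 0.
Proof.
rewrite /soft ler_norml => /andP[x1 x2].
by rewrite min_r // max_r // subrr.
Qed.

Lemma card_ge_markov (R : realType) (V : finType) (h : V -> R) (a s : R) :
  0 < a -> (forall v, 0 <= h v) ->
  #|V|%:R^-1 * \sum_v h v ^+ 2 <= s ->
  #|[set v | a <= h v]%SET|%:R * a ^+ 2 <= s * #|V|%:R.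
Proof.
move=> a0 h0 hs.
have [V0|V0] := posnP #|V|.
  rewrite V0 mulr0 (_ : #|_| = 0)%N ?mul0r //.
  by apply/eqP; rewrite -leqn0 -V0 max_card.
have {hs} : \sum_v h v ^+ 2 <= s * #|V|%:R.
  by rewrite -ler_pdivrMr ?ltr0n // mulrC.
apply: le_trans; rewrite -sumr_const mulr_suml.
rewrite [leRHS](bigID (fun v => v \in [set v | a <= h v]%SET)) /=.
rewrite -[leLHS]addr0 lerD ?sumr_ge0 //; last by move=> *; exact: exprn_ge0.
apply: ler_sum => v; rewrite inE mul1r => av.
by rewrite lerXn2r ?nnegrE // ltW.
Qed.

Lemma independent_le_alpha (Gr : multigraph) (I : {set vertex Gr}) :
  independent I -> (#|I| <= alpha Gr)%N.
Proof.
exact: (@leq_bigmax_cond _ (@independent Gr) (fun J : {set vertex Gr} => #|J|)).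
Qed.

(** * Sites and defects of a microstate *)

Section Coordinates.
Variables (R : realType) (V : finType) (sigma : F2 -> {perm V}) (ks : seq F2).
Hypothesis hom : perm_hom sigma.

Definition site (phi : V -> hardcore R) (v : V) : R := hc_val (phi v) 1%g.

Definition defect (phi : V -> hardcore R) (g : F2) (v : V) : R :=
  hc_val (phi v) g - site phi (sigma g^-1%g v).

(** Index 0 is the site and index j + 1 the defect at entry [j] of [ks]; a defect at g plus the site
    at g^-1 v recovers phi(v)_g. *)
Definition coordinate (phi : V -> hardcore R) (v : V) (j : nat) : R :=
  if j is j'.+1 then defect phi (nth 1%g ks j') v else site phi v.

Lemma hc_val_itv (x : hardcore R) g : 0 <= hc_val x g <= 1.
Proof. by have [/(_ g)] := set_mem (valP x). Qed.

Lemma coordinate_le1 phi v j : `|coordinate phi v j| <= 1.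
Proof.
rewrite ler_norml; case: j => [|j] /=; rewrite ?/defect /site.
  by have /andP[x0 x1] := hc_val_itv (phi v) 1%g; apply/andP; split; lra.
have /andP[x0 x1] := hc_val_itv (phi v) (nth 1%g ks j).
have /andP[y0 y1] := hc_val_itv (phi (sigma (nth 1%g ks j)^-1%g v)) 1%g.
by apply/andP; split; lra.
Qed.

(** If the sites at w and sw both exceed [t], the hard-core condition at sw forces phi(sw)_s = 0, so
    the defect at s in sw exceeds [t] in absolute value. Removing such vertices leaves an
    independent set. *)
Lemma support_card phi (t : R) : 0 <= t ->
  (#|[set v | (t < site phi v)%R]%SET| <= alpha (action_graph sigma) +
     (#|[set v | (t < `|defect phi gen_a v|)%R]%SET| +
      #|[set v | (t < `|defect phi gen_b v|)%R]%SET|))%N.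
Proof.
move=> t0; set J := [set v | _]%SET; pose bad s := [set v | (t < `|defect phi (gen s) v|)%R]%SET.
rewrite -/(bad false) -/(bad true).
pose J' := (J :\: (bad false :|: bad true))%SET.
have indJ : @independent (action_graph sigma) J'.
  apply/forallP => -[w s] /=; apply/negP => /andP[].
  rewrite !inE => /andP[_ tw] /andP[]; rewrite negb_or => /andP[nf nt] tsw.
  have : ~~ (t < `|defect phi (gen s) (sigma (gen s) w)|) by case: (s) nf nt => ? ?.
  case/negP; rewrite /defect -hom mulVg perm_hom1 //.
  have : hc_val (phi (sigma (gen s) w)) 1%g *
      hc_val (phi (sigma (gen s) w)) (1 * gen s)%g = 0.
    by have [_] := set_mem (valP (phi (sigma (gen s) w))); apply.
  rewrite mul1g => /eqP; rewrite mulf_eq0 => /orP[/eqP z|/eqP ->].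
    by move: tsw; rewrite /site z ltNge t0.
  by rewrite sub0r normrN ger0_norm // (le_trans t0) // ltW.
have -> : #|J| = (#|J :&: (bad false :|: bad true)| + #|J'|)%N by rewrite cardsID.
rewrite addnC leq_add //.
  exact: independent_le_alpha indJ.
apply: leq_trans (subset_leq_card (subsetIr _ _)) _.
by rewrite cardsU leq_subr.
Qed.

(** The sites contribute at most alpha + 2b by [support_card], and each of the [size ks] defects at
    most b. *)
Lemma coordinate_card phi (t : R) (b : nat) : 0 <= t ->
  gen_a \in ks -> gen_b \in ks ->
  (forall g, g \in ks -> #|[set v | (t < `|defect phi g v|)%R]%SET| <= b)%N ->
  (#|[set i : V * 'I_(size ks).+1 | (t < `|coordinate phi i.1 i.2|)%R]%SET| <=
    alpha (action_graph sigma) + (size ks + 2) * b)%N.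
Proof.
move=> t0 ka kb hb.
set S := [set i | _]%SET.
have -> : #|S| = (\sum_(j < (size ks).+1) #|[set v | (t < `|coordinate phi v j|)%R]%SET|)%N.
  rewrite -sum1dep_card big_mkcond /= -(pair_bigA _ (fun v (j : 'I_(size ks).+1) =>
    if (t < `|coordinate phi v j|)%R then 1 else 0)%N) exchange_big /=.
  by apply: eq_bigr => j _; rewrite -sum1dep_card [RHS]big_mkcond.
rewrite big_ord_recl /=.
have s0 : (#|[set v | (t < `|site phi v|)%R]%SET| <= alpha (action_graph sigma) + (b + b))%N.
  rewrite (leq_trans _ (leq_trans (support_card phi t0) _)) //.
    apply/subset_leq_card/fintype.subsetP => v; rewrite !inE ger0_norm //.
    by have /andP[] := hc_val_itv (phi v) 1%g.
  by rewrite leq_add2l leq_add // hb.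
apply: leq_trans (leq_add s0 _) (_ : (_ + size ks * b <= _)%N); last by lia.
apply: (@leq_trans (\sum_(j < size ks) b)); last by rewrite sum_nat_const card_ord.
by apply: leq_sum => j _; apply: (hb (nth 1%g ks j)); exact: mem_nth.
Qed.

End Coordinates.

Lemma hc_zero (R : realType) : (fun=> 0) \in @hc_set R.
Proof. by apply/mem_set; split=> [g|g s]; rewrite ?lexx ?ler01 ?mulr0. Qed.

(** * Covers of the spaces of microstates *)

Section Upper.
Variables (R : realType) (rho : hardcore R -> hardcore R -> R).
Hypothesis rhoC : compatible_metric rho.

(** The defect at g compares the entries at e of g^-1 phi(v) and phi(g^-1 v), so a large one forces
    distance at least [eta]; this is why g^-1 must be in [F]. *)
Lemma Map_defect_card (V : finType) (sigma : F2 -> {perm V}) (F : set F2)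
    (d t eta : R) (phi : V -> hardcore R) (g : F2) :
  0 < eta -> (forall x y, rho x y < eta -> `|hc_val x 1%g - hc_val y 1%g| < t) ->
  Map (@hc_shift R) rho F d sigma phi -> F g^-1%g ->
  #|[set v | t < `|defect sigma phi g v|]%SET|%:R * eta ^+ 2 <= d ^+ 2 * #|V|%:R.
Proof.
move=> eta0 etaP phiM /phiM; rewrite /rho2 => hd.
pose h v := rho (phi (sigma g^-1%g v)) (hc_shift g^-1%g (phi v)).
have h0 v : 0 <= h v by exact: (rho_ge0 rhoC).
have : #|V|%:R^-1 * \sum_v h v ^+ 2 <= d ^+ 2.
  have S0 : 0 <= #|V|%:R^-1 * \sum_v h v ^+ 2.
    by rewrite mulr_ge0 ?invr_ge0 // sumr_ge0 // => v _; rewrite exprn_ge0.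
  rewrite -(sqr_sqrtr S0) lerXn2r ?nnegrE ?sqrtr_ge0 //.
  exact: le_trans (sqrtr_ge0 _) hd.
move/(card_ge_markov eta0 h0); apply: le_trans.
rewrite ler_wpM2r ?exprn_ge0 ?(ltW eta0) // ler_nat.
apply/subset_leq_card/fintype.subsetP => v; rewrite !inE.
apply: contraTT; rewrite -!ltNge => /etaP /ltW; rewrite -leNgt distrC.
apply: le_trans; rewrite le_eqVlt; apply/orP; left; apply/eqP.
rewrite /defect /site; congr (`| _ - _ |).
change (hc_val (phi v) g = hc_val (phi v) (g^-1^-1 * 1)%g).
by rewrite invgK mulg1.
Qed.

Lemma coordinate_continuous (V : finType) (sigma : F2 -> {perm V}) (ks : seq F2)
    (M : set {ptws V -> hardcore R}) v j :
  continuous (fun phi : M => coordinate sigma ks (set_val phi : V -> hardcore R) v j).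
Proof.
have cv u g : continuous (fun phi : M => hc_val ((set_val phi : V -> hardcore R) u) g).
  move=> phi; apply: (@continuous_comp _ _ _
    (fun phi : M => (set_val phi : V -> hardcore R) u) (fun x => hc_val x g));
    last exact: hc_coord_continuous.
  apply: (@continuous_comp _ _ _ (@set_val _ M)
    (fun psi : {ptws V -> hardcore R} => psi u)); first exact: initial_continuous.
  exact: (@proj_continuous _ (fun=> hardcore R)).
case: j => [|j] /=; first exact: cv.
by move=> phi; exact: (cvgB (cv v (nth 1%g ks j) phi) (cv (sigma (nth 1%g ks j)^-1%g v) 1%g phi)).
Qed.

Lemma Dmap_le_alpha (U : set (set (hardcore R))) (eps : R) :
  fin_open_cover U -> 0 < eps ->
  exists (F : set F2) (d : R), [/\ finite_set F, F !=set0, 0 < d &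
    forall (V : finType) (sigma : F2 -> {perm V}), perm_hom sigma ->
    (Dmap (@hc_shift R) rho U F d sigma <=
      ((alpha (action_graph sigma))%:R + eps * #|V|%:R)%:E)%E].
Proof.
move=> Uc eps0; have [e [gs [e0 eP]]] := hardcore_coord_lebesgue Uc.
(* Sites and defects will vary by less than 3t on a member of the cover, hence entries by less than
   6t < e. *)
have [t tE] : exists t, t = e / 8 by exists (e / 8).
have t0 : 0 < t by rewrite tE divr_gt0.
have [eta eta0 etaP] := uniform_modulus rhoC (@hardcore_compact R)
  (@hc_coord_continuous R 1%g) t0.
have [n _ /(_ n (leqnn n)) /= nt] := near_infty_natSinv_lt (PosNum t0).
pose ks := [:: gen_a, gen_b & gs].
(* For each g at most s^2 |V| <= s |V| defects are large, and [size ks + 2] such sets amount to at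
   most eps |V|. *)
pose s := Num.min 1 (eps / (size ks + 2)%:R).
have s0 : 0 < s by rewrite lt_min ltr01 divr_gt0 ?ltr0n.
exists [set g^-1%g | g in [set` ks]], (eta * s); split.
- exact/finite_image/finite_seq.
- by exists gen_a^-1%g; exists gen_a => //=; rewrite mem_head.
- by rewrite mulr_gt0.
move=> V sigma hom; set F := [set _ | _ in _].
pose MM := Map (@hc_shift R) rho F (eta * s) sigma.
pose I := (V * 'I_(size ks).+1)%type.
pose f (i : I) (phi : MM) := coordinate sigma ks (set_val phi : V -> hardcore R) i.1 i.2.
(* Unit cells for [z] have mesh 1/(n+1) < t before scaling. The offset makes [z] nonnegative and
   sends thresholded coordinates to the integer n + 1. *)
pose z (i : I) (phi : MM) : R := n.+1%:R + n.+1%:R * soft t (f i phi).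
have zc i : continuous (z i).
  have c1 : continuous (fun phi : MM => soft t (f i phi)).
    move=> phi; apply: (@continuous_comp _ _ _ (f i) (soft t)).
      exact: coordinate_continuous.
    exact: soft_continuous.
  by move=> phi; exact: (cvgD (cvg_cst _) (cvgM (cvg_cst _) (c1 phi))).
have n0 : 0 < n.+1%:R :> R by rewrite ltr0n.
have zb i phi : 0 <= z i phi <= (n.+1 + n.+1)%:R.
  have : `|soft t (f i phi)| <= 1 by apply: soft_le1; [exact: ltW|exact: coordinate_le1].
  rewrite ler_norml natrD => /andP[h1 h2]; rewrite /z; apply/andP; split; nra.
have zoff phi : #|[set i | z i phi != n.+1%:R]%SET|%:R <=
    (alpha (action_graph sigma))%:R + eps * #|V|%:R.
  pose b := Num.truncn (s * #|V|%:R).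
  have sV0 : 0 <= s * #|V|%:R by rewrite mulr_ge0 // ltW.
  have bs : b%:R <= s * #|V|%:R by have /andP[] := truncn_itv sV0.
  have hb g : g \in ks ->
      (#|[set v | (t < `|defect sigma (set_val phi) g v|)%R]%SET| <= b)%N.
    move=> gks; rewrite -ltnS -(ltr_nat R).
    have /andP[_] := truncn_itv sV0; apply: le_lt_trans.
    have := @Map_defect_card V sigma F (eta * s) t eta (set_val phi) g eta0 etaP
      (set_mem (valP phi)).
    move=> /(_ (ex_intro2 _ _ g gks erefl)).
    move=> h; rewrite -(@ler_pM2r _ (eta ^+ 2)) ?exprn_gt0 //; apply: le_trans h _.
    have -> : (eta * s) ^+ 2 * #|V|%:R = s * s * #|V|%:R * eta ^+ 2 by ring.
    rewrite ler_wpM2r ?exprn_ge0 ?(ltW eta0) // ler_wpM2r // ler_piMl ?(ltW s0) //.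
    by rewrite /s ge_min lexx.
  apply: (@le_trans _ _ (alpha (action_graph sigma) + (size ks + 2) * b)%:R).
    rewrite ler_nat; apply: leq_trans (coordinate_card hom (ltW t0) _ _ hb).
    - apply/subset_leq_card/fintype.subsetP => i; rewrite !inE /z.
      apply: contraTT; rewrite -leNgt negbK => ft; rewrite soft_eq0 //.
      by rewrite mulr0 addr0.
    - by rewrite mem_head.
    - by rewrite inE mem_head orbT.
  rewrite natrD lerD2l natrM.
  apply: (@le_trans _ _ ((size ks + 2)%:R * (s * #|V|%:R))).
    by rewrite ler_wpM2l.
  rewrite mulrA ler_wpM2r // mulrC -ler_pdivlMr ?ltr0n //.
  by rewrite /s ge_min lexx orbT.
have [beta [bc bo bsmall]] := grid_cover zc zb zoff.
apply: le_trans bo; apply: ereal_inf_lbound; exists beta => //; split=> // B bB.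
(* One [t] comes from the mesh and one from thresholding each of the two values. *)
have fsmall i p q : B p -> B q -> `|f i p - f i q| < 3 * t.
  move=> Bp Bq; have := bsmall B bB p q i Bp Bq.
  rewrite /z opprD addrACA subrr add0r -mulrBr normrM ger0_norm ?(ltW n0) //.
  rewrite -ltr_pdivlMl // mulr1 => /lt_trans/(_ nt) zz.
  have := soft_near (f i p) (ltW t0); have := soft_near (f i q) (ltW t0).
  move: zz; rewrite !ltr_norml !ler_norml.
  move=> /andP[? ?] /andP[? ?] /andP[? ?]. apply/andP; split; lra.
have [W [UW BW]] : exists W : V -> set (hardcore R), (forall v, U (W v)) /\
    forall p, B p -> forall v, W v ((set_val p : V -> hardcore R) v).
  (* A point [p] of [B] serves as centre; for empty [B] any member of [U] will do. *)
  have [[p Bp]|nB] := pselect (B !=set0); last first.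
    have [W UW _] := eP (exist (fun x => x \in @hc_set R) _ (hc_zero R)).
    by exists (fun=> W); split=> // p Bp; case: nB; exists p.
  have /choice[W WP] : forall v, exists W, U W /\ forall y,
      (forall g, g \in gs ->
         `|hc_val ((set_val p : V -> hardcore R) v) g - hc_val y g| <= e) -> W y.
    by move=> v; have [W] := eP ((set_val p : V -> hardcore R) v); exists W.
  exists W; split=> [v|q Bq v]; first by have [] := WP v.
  have [_] := WP v; apply=> g ggs.
  have gks : g \in ks by rewrite !inE ggs !orbT.
  have jk : ((index g ks).+1 < (size ks).+1)%N by rewrite ltnS index_mem.
  have h1 : `|defect sigma (set_val p) g v - defect sigma (set_val q) g v| < 3 * t.
    rewrite -(nth_index 1%g gks); exact: (fsmall (v, Ordinal jk) p q Bp Bq).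
  have h2 : `|site (set_val p) (sigma g^-1%g v) - site (set_val q) (sigma g^-1%g v)| < 3 * t.
    exact: (fsmall (sigma g^-1%g v, ord0) p q Bp Bq).
  move: h1 h2; rewrite /defect !ltr_norml ler_norml tE.
  move=> /andP[? ?] /andP[? ?]; apply/andP; split; lra.
exists [set phi : MM | forall v, W v ((set_val phi : V -> hardcore R) v)] => //.
exists [set phi : {ptws V -> hardcore R} | forall v, W v (phi v)] => //.
by exists W.
Qed.

End Upper.

(** * Bipartite quotients *)

Section BipartiteQuotient.
Variables (chi : F2 -> 'Z_2).
Hypothesis chi_hom : forall g h : F2, chi (g * h)%g = chi g + chi h.
Hypotheses (chi_a : chi gen_a = 1) (chi_b : chi gen_b = 1).
Variable N : fin_index_normal F2.
Hypothesis N_ker : forall g, (N : set F2) g -> chi g = 0.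

Let sigma := @translation F2 N.

Lemma quot_gt0 : (0 < #|quot N|)%N.
Proof.
have NN : ltrans 1%g N \in fset_set (lcosets_of N).
  by rewrite (in_fset_set (fin_normal_index N)); apply/mem_set; exists 1%g.
by apply/card_gt0P; exists (finmap.FSetSub NN).
Qed.

(** [chi] on the quotient, read off a chosen representative; the choice is immaterial because [chi]
    vanishes on [N]. *)
Definition parity (C : quot N) : 'Z_2 := chi (xget 1%g (val C)).

Lemma parityE (C : quot N) g : (val C) g -> parity C = chi g.
Proof.
move=> Cg; have /(xgetPex 1%g) : exists h, (val C) h by exists g.
rewrite /parity; move: (xget _ _) => h; move: Cg.
have := valP C; rewrite (in_fset_set (fin_normal_index N)) => /set_mem[k _ <-].
move=> [x Nx <-] [y Ny <-].
by rewrite !chi_hom (N_ker Nx) (N_ker Ny).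
Qed.

Lemma parity_translation g C : parity (sigma g C) = chi g + parity C.
Proof.
have [h Ch] : exists h, (val C) h.
  have := valP C; rewrite (in_fset_set (fin_normal_index N)) => /set_mem[k _ <-].
  by exists (k * 1)%g; exists 1%g => //; exact: fin_normal1.
rewrite (parityE Ch) -chi_hom; apply: parityE.
by rewrite /sigma /translation permE; exists h.
Qed.

Definition even_cosets : {set quot N} := [set C | parity C == 0]%SET.

Lemma chi_gen s : chi (gen s) = 1.
Proof. by case: s. Qed.

Lemma Z2_addK1 (x : 'Z_2) : (1 + x == 0) = (x != 0).
Proof. by case: x => [[|[|x]] ?]. Qed.

Lemma even_independent : @independent (action_graph sigma) even_cosets.
Proof.
apply/forallP => -[C s] /=; rewrite !inE parity_translation chi_gen Z2_addK1.
by case: (_ == _).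
Qed.

(** Translation by a exchanges even and odd cosets. *)
Lemma even_cosets_card : (#|even_cosets| * 2 = #|quot N|)%N.
Proof.
have aE C : (sigma gen_a C \in even_cosets) = (C \notin even_cosets).
  by rewrite !inE parity_translation chi_a Z2_addK1.
have inj : injective (sigma gen_a) by exact: perm_inj.
have h1 : (#|even_cosets| <= #|~: even_cosets|)%N.
  rewrite -(card_imset (mem even_cosets) inj); apply/subset_leq_card/fintype.subsetP.
  by move=> _ /imsetP[C CE ->]; rewrite inE aE negbK.
have h2 : (#|~: even_cosets| <= #|even_cosets|)%N.
  rewrite -(card_imset (mem (~: even_cosets)) inj); apply/subset_leq_card/fintype.subsetP.
  by move=> _ /imsetP[C CE ->]; rewrite aE; move: CE; rewrite inE.
by rewrite muln2 -addnn -(cardsC even_cosets); lia.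
Qed.

Lemma independent_card (V : finType) (tau : F2 -> {perm V}) (I : {set V}) :
  @independent (action_graph tau) I -> (#|I| * 2 <= #|V|)%N.
Proof.
move=> indI; have inj : injective (tau gen_a) by exact: perm_inj.
have : (#|I| <= #|~: I|)%N.
  rewrite -(card_imset (mem I) inj); apply/subset_leq_card/fintype.subsetP.
  move=> _ /imsetP[v vI ->]; rewrite inE; apply/negP => vI'.
  by move/forallP: indI => /(_ (v, false)); rewrite /= vI vI'.
by rewrite muln2 -addnn -(cardsC I) leq_add2l.
Qed.

Lemma alpha_quot : (alpha (action_graph sigma) * 2 = #|quot N|)%N.
Proof.
apply/eqP; rewrite eqn_leq; apply/andP; split.
  rewrite -leq_divRL //; apply/bigmax_leqP => I indI.
  by rewrite leq_divRL //; exact: (@independent_card (quot N) sigma I).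
rewrite -even_cosets_card leq_mul2r /=.
exact: independent_le_alpha even_independent.
Qed.

End BipartiteQuotient.

(** * Upper limits and the value of the mean dimension *)

Lemma limn_esup_le (R : realType) (u : nat -> \bar R) (c : \bar R) :
  (forall n, (u n <= c)%E) -> (limn_esup u <= c)%E.
Proof.
move=> uc; apply: le_trans (_ : (ereal_sup (range u) <= c)%E).
  by apply: ereal_inf_lbound; exists setT => //; exact: filterT.
by apply: ge_ereal_sup => _ [n _ <-].
Qed.

Lemma limn_esup_ge (R : realType) (u : nat -> \bar R) (c : \bar R) :
  (forall n, (c <= u n)%E) -> (c <= limn_esup u)%E.
Proof.
move=> cu; apply: le_ereal_inf_tmp => _ [A [n _ nA] <-].
apply: le_trans (cu n) _; apply: ereal_sup_ubound; exists n => //.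
by apply: nA => /=.
Qed.

Theorem proposition4p2 (R : realType)
  (chi : F2 -> 'Z_2)
  (chi_hom : forall g h : F2, chi (g * h)%g = chi g + chi h)
  (chi_a : chi gen_a = 1) (chi_b : chi gen_b = 1)
  (N : nat -> fin_index_normal F2)
  (N_ker : forall n g, (N n : set F2) g -> chi g = 0)
  (N_cap : \bigcap_n (N n : set F2) = [set 1%g])
  (N_sofic : hom_sofic_approx R (fun n => @translation F2 (N n))) :
  (forall n, (alpha (action_graph (@translation F2 (N n))))%:R
             = #|quot (N n)|%:R / 2 :> R) /\
  (forall rho : hardcore R -> hardcore R -> R, compatible_metric rho ->
     mdim (@hc_shift R) rho (fun n => @translation F2 (N n)) = (1 / 2)%:E).
Proof.
have alphaE n : (alpha (action_graph (@translation F2 (N n))))%:R =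
    #|quot (N n)|%:R / 2 :> R.
  rewrite -(alpha_quot chi_hom chi_a chi_b (N_ker n)) natrM; lra.
split=> // rho rhoC; have hom := sofic_hom N_sofic.
have V0 n : 0 < #|quot (N n)|%:R :> R by rewrite ltr0n quot_gt0.
apply/eqP; rewrite eq_le; apply/andP; split.
  (* For each cover and each e > 0, one choice of [F] and [d] bounds every term by 1/2 + e. *)
  apply: ge_ereal_sup => _ [U Uc <-]; apply/lee_addgt0Pr => e e0.
  have [F [d [fF F0 d0 FP]]] := Dmap_le_alpha rhoC Uc e0.
  apply: (@le_trans _ _ (limn_esup (fun n => Dmap (@hc_shift R) rho U F d
      (@translation F2 (N n)) * (#|quot (N n)|%:R^-1)%:E)%E)); last first.
    apply: limn_esup_le => n.
    rewrite -lee_pdivlMr ?invr_gt0 // invrK; apply: le_trans (FP _ _ (hom n)) _.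
    by rewrite alphaE -EFinD -EFinM lee_fin mulrDl mul1r mulrC.
  apply: le_trans (ereal_inf_lbound _) _; first by exists F.
  by apply: ereal_inf_lbound; exists d.
(* The single cover [site_cover] suffices: the even cosets give at least 1/2 for all [F], [d] and
   [n]. *)
apply: le_trans (ereal_sup_ubound _); last first.
  by exists (@site_cover R); first exact: site_cover_open.
apply: le_ereal_inf_tmp => _ [F _ <-]; apply: le_ereal_inf_tmp => _ [d d0 <-].
apply: limn_esup_ge => n.
rewrite -lee_pdivrMr ?invr_gt0 // invrK.
apply: le_trans (Dmap_ge_card (hom n) (even_independent chi_hom chi_a chi_b (N_ker n)) rhoC F d0).
rewrite -EFinM lee_fin -(even_cosets_card chi_hom chi_a (N_ker n)) natrM.
lra.
Qed.
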